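(* Let $S$ be a finite nonempty subset of $\mathbb{Z}$ and let $U$ be an irreducible $\mathfrak{gl}_S$-module. Then $L(S,U)$ is an irreducible $\mathfrak{gl}_\infty$-module belonging to the category $\mathcal{C}$. On the other hand, every irreducible $\mathfrak{gl}_\infty$-module in the category $\mathcal{C}$ is isomorphic to $L(S,U)$ for some finite nonempty subset $S$ of $\mathbb{Z}$ and some irreducible $\mathfrak{gl}_S$-module $U$.
   Context: All vector spaces are over $\mathbb{C}$. $\mathfrak{gl}_\infty$ is the Lie algebra of doubly infinite matrices (indexed by $\mathbb{Z}\times\mathbb{Z}$) with finitely many nonzero entries, with basis the matrix units $E_{m,n}$ ($m,n\in\mathbb{Z}$) and $[E_{m,n},E_{r,s}]=\delta_{n,r}E_{m,s}-\delta_{m,s}E_{r,n}$. $\mathcal{C}$ is the category of $\mathfrak{gl}_\infty$-modules $W$ such that for every $w\in W$ there is a finite subset $T\subset\mathbb{Z}$ with $E_{m,n}w=0$ for all $m,n\in\mathbb{Z}$ with $n\notin T$. For a finite nonempty $S\subset\mathbb{Z}$ put $\mathfrak{gl}_S=\mathrm{span}\{E_{m,n}: m,n\in S\}$, $\mathfrak{gl}_\infty^{(S,+)}=\mathrm{span}\{E_{m,n}: m\in\mathbb{Z},\ n\notin S\}$, $\mathfrak{gl}_\infty^{(S,-)}=\mathrm{span}\{E_{m,n}: m\notin S,\ n\in S\}$. For a $\mathfrak{gl}_S$-module $U$, let $\mathfrak{gl}_\infty^{(S,+)}$ act trivially on $U$, and set $M(S,U)=U(\mathfrak{gl}_\infty)\otimes_{U(\mathfrak{gl}_\infty^{(S,+)}+\mathfrak{gl}_S)}U$.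 Give $\mathfrak{gl}_\infty$ the $\mathbb{Z}$-grading in which $E_{m,n}$ has degree $1$ if $m\in S,n\notin S$, degree $-1$ if $m\notin S,n\in S$, and degree $0$ otherwise; with $U$ in degree $0$, $M(S,U)$ is a $\mathbb{Z}$-graded module with degree-$0$ subspace $U$. $L(S,U)$ is the quotient of $M(S,U)$ by the maximal graded submodule whose degree-$0$ homogeneous subspace is zero. *)

(* Defs.v *)
From HB Require Import structures.
From mathcomp Require Import all_boot all_order all_algebra finmap.
From mathcomp Require Import boolp classical_sets reals.
From mathcomp Require Import monalg complex.

Set Implicit Arguments.
Unset Strict Implicit.
Unset Printing Implicit Defensive.

Import GRing.Theory.
Local Open Scope classical_set_scope.
Local Open Scope ring_scope.
Local Open Scope quotient_scope.

Definition subspace (K : fieldType) (V : lmodType K) (N : set V) : Prop :=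
  N 0 /\ forall (a : K) (x y : V), N x -> N y -> N (a *: x + y).

Definition span (K : fieldType) (V : lmodType K) (A : set V) : set V :=
  [set x | forall N : set V, subspace N -> A `<=` N -> N x].

Section RawLinear.
Context {K : fieldType} {V W : lmodType K} {f : V -> W}.
Hypothesis lf : linear f.

Lemma linB x y : f (x - y) = f x - f y.
Proof. by rewrite addrC -scaleN1r lf scaleN1r addrC. Qed.

Lemma lin0 : f 0 = 0.
Proof. by rewrite -(subrr 0) linB subrr. Qed.

Lemma linD x y : f (x + y) = f x + f y.
Proof. by rewrite -[x]scale1r lf !scale1r. Qed.

Lemma linZ a x : f (a *: x) = a *: f x.
Proof. by rewrite -[a *: x]addr0 lf lin0 addr0. Qed.

Lemma lin_sum (I : Type) (r : seq I) (P : pred I) (F : I -> V) :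
  f (\sum_(i <- r | P i) F i) = \sum_(i <- r | P i) f (F i).
Proof. exact: (big_morph f linD lin0). Qed.

End RawLinear.

Lemma linear_comb (K : fieldType) (V W : lmodType K) (c : K) (f g : V -> W) :
  linear f -> linear g -> linear (fun x => c *: f x + g x).
Proof.
move=> lf lg a x y; rewrite lf lg !scalerDr !scalerA (mulrC a) !addrA.
by congr (_ + _); rewrite addrAC.
Qed.

Lemma linear_comp (K : fieldType) (U V W : lmodType K) (f : V -> W) (g : U -> V) :
  linear f -> linear g -> linear (fun x => f (g x)).
Proof. by move=> lf lg a x y; rewrite lg lf. Qed.

Section Span.
Context {K : fieldType} {V : lmodType K}.
Implicit Types (A B N : set V).

Lemma subset_span A : A `<=` span A.
Proof. by move=> x Ax N _; apply. Qed.

Lemma span_subspace A : subspace (span A).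
Proof.
split=> [N [] //|a x y sx sy N sN AN].
by apply: sN.2; [apply: sx | apply: sy].
Qed.

Lemma span_min A N : subspace N -> A `<=` N -> span A `<=` N.
Proof. by move=> sN AN x; apply. Qed.

Lemma span0 A : span A 0. Proof. exact: (span_subspace A).1. Qed.

Lemma spanP A a x y : span A x -> span A y -> span A (a *: x + y).
Proof. exact: (span_subspace A).2. Qed.

Lemma spanZ A a x : span A x -> span A (a *: x).
Proof. by move=> sx; rewrite -[_ *: _]addr0; apply: spanP => //; exact: span0. Qed.

Lemma spanD A x y : span A x -> span A y -> span A (x + y).
Proof. by move=> sx sy; rewrite -[x]scale1r; apply: spanP. Qed.

Lemma spanN A x : span A x -> span A (- x).
Proof. by move=> sx; rewrite -scaleN1r; apply: spanZ. Qed.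

Lemma spanB A x y : span A x -> span A y -> span A (x - y).
Proof. by move=> sx sy; apply: spanD => //; apply: spanN. Qed.

Lemma span_sum A (I : Type) (r : seq I) (P : pred I) (F : I -> V) :
  (forall i, P i -> span A (F i)) -> span A (\sum_(i <- r | P i) F i).
Proof. by move=> sF; elim/big_ind : _ => //; [exact: span0 | exact: spanD]. Qed.

End Span.

Lemma span_linear (K : fieldType) (V W : lmodType K) (A : set V) (B : set W)
    (f : V -> W) : linear f ->
  (forall x, A x -> span B (f x)) -> forall x, span A x -> span B (f x).
Proof.
move=> lf AB x; apply: (@span_min _ _ A (f @^-1` span B)) => //.
split=> [|a y z /= sy sz]; first by rewrite /= (lin0 lf); exact: span0.
by rewrite lf; apply: spanP.
Qed.

Lemma eq_linear_span (K : fieldType) (V W : lmodType K) (A : set V)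
    (f g : V -> W) : linear f -> linear g ->
  (forall x, A x -> f x = g x) -> forall x, span A x -> f x = g x.
Proof.
move=> lf lg fg; apply: (@span_min _ _ _ [set x | f x = g x]) => //.
split=> [|a y z /= hy hz]; first by rewrite /= (lin0 lf) (lin0 lg).
by rewrite lf lg hy hz.
Qed.

Definition span_pred (K : fieldType) (V : lmodType K) (A : set V) : {pred V} :=
  fun x => `[< span A x >].

Lemma span_pred_zmod_closed (K : fieldType) (V : lmodType K) (A : set V) :
  zmod_closed (span_pred A).
Proof.
split=> [|x y /asboolP sx /asboolP sy]; apply/asboolP; first exact: span0.
exact: spanB.
Qed.

HB.instance Definition _ (K : fieldType) (V : lmodType K) (A : set V) :=
  GRing.isZmodClosed.Build V (span_pred A) (span_pred_zmod_closed A).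

(* The quotient of V by the subspace spanned by A. *)
Definition quot (K : fieldType) (V : lmodType K) (A : set V) : Type :=
  Quotient.quot (span_pred A).

Section Quot.
Context {K : fieldType} {V : lmodType K} (A : set V).

HB.instance Definition _ := GRing.Zmodule.on (quot A).

Definition qpi (x : V) : quot A := \pi_(Quotient.quot (span_pred A)) x.
Definition qrepr (x : quot A) : V := repr (x : Quotient.quot (span_pred A)).

Lemma qreprK x : qpi (qrepr x) = x.
Proof. exact: reprK. Qed.

Lemma qpi_eq x y : (qpi x = qpi y) <-> span A (x - y).
Proof.
split=> [/eqP|sxy]; first by rewrite /qpi piE => /asboolP.
by apply/eqP; rewrite /qpi piE; apply/asboolP.
Qed.

Lemma qpiB x y : qpi (x - y) = qpi x - qpi y.
Proof. by rewrite /qpi [LHS]raddfB. Qed.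

Lemma qpi0 : qpi 0 = 0.
Proof. by rewrite -[0 in LHS](subrr 0) qpiB subrr. Qed.

Lemma qpi_eq0 x : (qpi x = 0) <-> span A x.
Proof. by rewrite -qpi0 qpi_eq subr0. Qed.

Lemma qpiD x y : qpi (x + y) = qpi x + qpi y.
Proof. by rewrite /qpi [LHS]raddfD. Qed.

Definition qscale (a : K) (x : quot A) : quot A := qpi (a *: qrepr x).

Lemma qpiZ a x : qpi (a *: x) = qscale a (qpi x).
Proof.
by apply/qpi_eq; rewrite -scalerBr; apply: spanZ; apply/qpi_eq; rewrite qreprK.
Qed.

Fact qscalerA a b x : qscale a (qscale b x) = qscale (a * b) x.
Proof. by rewrite -[x]qreprK -!qpiZ scalerA. Qed.
Fact qscale1r x : qscale 1 x = x.
Proof. by rewrite -[x]qreprK -!qpiZ scale1r. Qed.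
Fact qscalerDr : right_distributive qscale +%R.
Proof.
by move=> a x y; rewrite -[x]qreprK -[y]qreprK -qpiD -!qpiZ -qpiD scalerDr.
Qed.
Fact qscalerDl x : {morph qscale^~ x : a b / a + b}.
Proof. by move=> a b /=; rewrite -[x]qreprK -!qpiZ -qpiD scalerDl. Qed.

HB.instance Definition _ := GRing.Zmodule_isLmodule.Build K (quot A)
  qscalerA qscale1r qscalerDr qscalerDl.

Lemma qpi_linear : linear qpi.
Proof. by move=> a x y; rewrite qpiD qpiZ. Qed.

HB.instance Definition _ := GRing.isLinear.Build K V (quot A) *:%R qpi qpi_linear.

Definition qlift (W : lmodType K) (f : V -> W) (x : quot A) : W := f (qrepr x).

Section Lift.
Variables (W : lmodType K) (f : V -> W).
Hypotheses (f_lin : linear f) (fA : forall x, A x -> f x = 0).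

Lemma qliftE x : qlift f (qpi x) = f x.
Proof.
apply/eqP; rewrite -subr_eq0 -(linB f_lin); apply/eqP.
have : span A (qrepr (qpi x) - x) by apply/qpi_eq; rewrite qreprK.
apply: (@span_min _ _ _ [set z | f z = 0]) => //; split=> [|a y z /= fy fz].
  by rewrite /= (lin0 f_lin).
by rewrite f_lin fy fz scaler0 addr0.
Qed.

Lemma qlift_linear : linear (qlift f).
Proof.
move=> a x y; rewrite -[x]qreprK -[y]qreprK.
by rewrite -[a *: qpi _ + _](qpi_linear a) !qliftE f_lin.
Qed.

End Lift.
End Quot.

(* The linear extension of f from the basis X of the free space {malg K[X]} *)
Definition lin_ext (K : fieldType) (X : choiceType) (V : lmodType K)
    (f : X -> V) (a : {malg K[X]}) : V :=
  \sum_(k <- msupp a) a@_k *: f k.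

Section LinExt.
Context {K : fieldType} {X : choiceType} {V : lmodType K}.
Implicit Types (f g : X -> V) (a b : {malg K[X]}).

Lemma lin_extEw f (d : {fset X}) a : (msupp a `<=` d)%fset ->
  lin_ext f a = \sum_(k <- d) a@_k *: f k.
Proof.
move=> le; rewrite [LHS](big_fset_incl _ le) => //= x xd /mcoeff_outdom ->.
by rewrite scale0r.
Qed.

Lemma lin_extU f c k : lin_ext f << c *g k >> = c *: f k.
Proof. by rewrite (lin_extEw _ msuppU_le) big_seq_fset1 mcoeffUU. Qed.

Lemma lin_ext1 f k : lin_ext f << k >> = f k.
Proof. by rewrite lin_extU scale1r. Qed.

Lemma lin_ext_linear f : linear (lin_ext f).
Proof.
move=> c a b; pose d := (msupp a `|` msupp b `|` msupp (c *: a + b))%fset.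
rewrite !(@lin_extEw f d) ?fsubsetUr //; first last.
- by rewrite /d -fsetUA fsubsetUl.
- by rewrite /d fsetUAC fsubsetUr.
rewrite scaler_sumr -big_split /=; apply: eq_bigr => k _.
by rewrite mcoeffD mcoeffZ scalerDl scalerA.
Qed.

HB.instance Definition _ f :=
  GRing.isLinear.Build K {malg K[X]} V *:%R (lin_ext f) (lin_ext_linear f).

Lemma malgUZ c (k : X) : << c *g k >> = c *: << k >> :> {malg K[X]}.
Proof. by apply/malgP => j; rewrite mcoeffZ !mcoeffU mulrnAr mulr1. Qed.

Lemma linear_malgE (f : {malg K[X]} -> V) : linear f ->
  f =1 lin_ext (fun k => f << k >>).
Proof.
move=> lf a; rewrite [in LHS](monalgE a) (lin_sum lf).
by apply: eq_bigr => k _; rewrite malgUZ (linZ lf).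
Qed.

Lemma eq_lin_ext f g : f =1 g -> lin_ext f =1 lin_ext g.
Proof. by move=> fg a; apply: eq_bigr => k _; rewrite fg. Qed.

End LinExt.

HB.mixin Record Lmodule_isLieAlgebra (K : fieldType) L of GRing.Lmodule K L := {
  lie : L -> L -> L;
  lie_linearl : forall y : L, linear (lie^~ y);
  lie_linearr : forall x : L, linear (lie x);
  lie_alt : forall x : L, lie x x = 0;
  lie_jacobi : forall x y z : L,
    lie x (lie y z) + lie y (lie z x) + lie z (lie x y) = 0
}.

#[short(type="lieAlgType")]
HB.structure Definition LieAlgebra (K : fieldType) :=
  { L of GRing.Lmodule K L & Lmodule_isLieAlgebra K L }.

HB.mixin Record Lmodule_isLieModule (K : fieldType) (L : lieAlgType K) W
    of GRing.Lmodule K W := {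
  lact : L -> W -> W;
  lact_linearl : forall w : W, linear (lact^~ w);
  lact_linearr : forall x : L, linear (lact x);
  lact_lie : forall (x y : L) (w : W),
    lact (lie x y) w = lact x (lact y w) - lact y (lact x w)
}.

#[short(type="lieModType")]
HB.structure Definition LieModule (K : fieldType) (L : lieAlgType K) :=
  { W of GRing.Lmodule K W & Lmodule_isLieModule K L W }.

Section LieModules.
Context {K : fieldType} {L : lieAlgType K}.

Definition submodule (W : lieModType L) (N : set W) : Prop :=
  subspace N /\ forall (x : L) (w : W), N w -> N (lact x w).

Definition irreducible (W : lieModType L) : Prop :=
  (exists w : W, w != 0) /\
  forall N : set W, submodule N -> N = [set 0] \/ N = [set: W].

Definition lie_isomorphic (V W : lieModType L) : Prop :=
  exists f : {linear V -> W},
    bijective f /\ forall (x : L) (v : V), f (lact x v) = lact x (f v).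

End LieModules.

(* The action of L on W / span A when span A is a submodule *)
Section QuotientAction.
Context {K : fieldType} {L : lieAlgType K} {W : lieModType L} (A : set W).

Definition qlact (x : L) (w : quot A) : quot A :=
  qlift (fun z => qpi A (lact x z)) w.

Hypothesis sA : submodule (span A).

Let qpi_lact_linear x : linear (fun z => qpi A (lact x z)).
Proof. exact: (linear_comp (@qpi_linear _ _ A) (lact_linearr x)). Qed.

Let qpi_lact0 x z : A z -> qpi A (lact x z) = 0.
Proof. by move=> Az; apply/qpi_eq0; apply: sA.2; exact: subset_span. Qed.

Lemma qlactE x z : qlact x (qpi A z) = qpi A (lact x z).
Proof. exact: (qliftE (qpi_lact_linear x) (@qpi_lact0 x)). Qed.

Lemma qlact_linearr x : linear (qlact x).
Proof. exact: (qlift_linear (qpi_lact_linear x) (@qpi_lact0 x)). Qed.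

Lemma qlact_linearl w : linear (qlact^~ w).
Proof.
move=> a x y; rewrite -[w]qreprK !qlactE lact_linearl.
exact: qpi_linear.
Qed.

Lemma qlact_lie x y w :
  qlact (lie x y) w = qlact x (qlact y w) - qlact y (qlact x w).
Proof.
rewrite -[w]qreprK !qlactE lact_lie.
exact: (linB (@qpi_linear _ _ A)).
Qed.

End QuotientAction.

Record lieSubalg (K : fieldType) (L : lieAlgType K) := LieSubalg {
  lsub_set :> L -> Prop;
  lsub_subspace : subspace (lsub_set : set L);
  lsub_lie : forall x y : L, lsub_set x -> lsub_set y -> lsub_set (lie x y)
}.

Section LieSubalgebra.
Context {K : fieldType} {L : lieAlgType K} (h : lieSubalg L).

Definition lsub_pred : {pred L} := fun x => `[< h x >].

Lemma lsub_pred_closed : subsemimod_closed lsub_pred.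
Proof.
have [h0 hP] := lsub_subspace h.
split=> [|a x /asboolP hx]; last first.
  by apply/asboolP; rewrite -[_ *: _]addr0; apply: hP.
split=> [|x y /asboolP hx /asboolP hy]; apply/asboolP => //.
by rewrite -[x]scale1r; apply: hP.
Qed.

HB.instance Definition _ := GRing.isSubmodClosed.Build K L lsub_pred
  lsub_pred_closed.

(* The Lie subalgebra h as a Lie algebra in its own right. *)
Record subLie : Type := SubLie { sublie_val : L; _ : sublie_val \in lsub_pred }.

HB.instance Definition _ := [isSub for sublie_val].
HB.instance Definition _ := [Choice of subLie by <:].
HB.instance Definition _ := [SubChoice_isSubLmodule of subLie by <:].

Lemma sublieP (x : subLie) : h (sublie_val x).
Proof. by case: x => x /= /asboolP. Qed.

Lemma sublie_mem (x : L) : h x -> x \in lsub_pred.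
Proof. by move=> hx; apply/asboolP. Qed.

Lemma sublie_val_linear : linear sublie_val.
Proof. by move=> a x y; exact: (linearP (val : {linear subLie -> L})). Qed.

Definition sublie_lie (x y : subLie) : subLie :=
  SubLie (sublie_mem (lsub_lie (sublieP x) (sublieP y))).

Fact sublie_lie_linearl y : linear (sublie_lie^~ y).
Proof.
move=> a x z; apply: val_inj; rewrite [RHS]sublie_val_linear.
rewrite -[LHS]/(lie (sublie_val (a *: x + z)) (sublie_val y)) sublie_val_linear.
exact: (lie_linearl (sublie_val y)).
Qed.

Fact sublie_lie_linearr x : linear (sublie_lie x).
Proof.
move=> a y z; apply: val_inj; rewrite [RHS]sublie_val_linear.
rewrite -[LHS]/(lie (sublie_val x) (sublie_val (a *: y + z))) sublie_val_linear.
exact: (lie_linearr (sublie_val x)).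
Qed.

Fact sublie_lie_alt x : sublie_lie x x = 0.
Proof. by apply: val_inj; rewrite /= lie_alt. Qed.

Fact sublie_lie_jacobi x y z :
  sublie_lie x (sublie_lie y z) + sublie_lie y (sublie_lie z x)
    + sublie_lie z (sublie_lie x y) = 0.
Proof.
by apply: val_inj; rewrite [LHS](linD sublie_val_linear) (linD sublie_val_linear) lie_jacobi.
Qed.

HB.instance Definition _ := Lmodule_isLieAlgebra.Build K subLie
  sublie_lie_linearl sublie_lie_linearr sublie_lie_alt sublie_lie_jacobi.

End LieSubalgebra.

Section IdealQuotient.
Context {K : fieldType} {A : algType K} (R : set A).

(* This set spans the two-sided ideal generated by R. *)
Definition ideal_gen : set A :=
  [set z | exists a r b : A, R r /\ z = a * r * b].

Lemma ideal_mull a x : span ideal_gen x -> span ideal_gen (a * x).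
Proof.
apply: (@span_linear _ _ _ _ _ ( *%R a)) => [c y z|y [b [r [d [er ->]]]]].
  by rewrite mulrDr scalerAr.
by apply: subset_span; exists (a * b), r, d; rewrite !mulrA.
Qed.

Lemma ideal_mulr a x : span ideal_gen x -> span ideal_gen (x * a).
Proof.
apply: (@span_linear _ _ _ _ _ ( *%R^~ a)) => [c y z|y [b [r [d [er ->]]]]].
  by rewrite mulrDl scalerAl.
by apply: subset_span; exists b, r, (d * a); rewrite !mulrA.
Qed.

Lemma ideal_sub r : R r -> span ideal_gen r.
Proof. by move=> Rr; apply: subset_span; exists 1, r, 1; rewrite mul1r mulr1. Qed.

Local Notation Q := (quot ideal_gen).
Local Notation p := (qpi ideal_gen).

Definition iq_mul (x y : Q) : Q := p (qrepr x * qrepr y).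

Lemma iq_piM x y : p (x * y) = iq_mul (p x) (p y).
Proof.
apply/qpi_eq.
have -> : x * y - qrepr (p x) * qrepr (p y) =
   (x - qrepr (p x)) * y + qrepr (p x) * (y - qrepr (p y)).
  by rewrite mulrBl mulrBr addrA subrK.
by apply: spanD; [apply: ideal_mulr|apply: ideal_mull];
   apply/qpi_eq; rewrite qreprK.
Qed.

Lemma iq_mulA : associative iq_mul.
Proof.
by move=> x y z; rewrite -[x]qreprK -[y]qreprK -[z]qreprK -!iq_piM mulrA.
Qed.
Lemma iq_mul1 : left_id (p 1) iq_mul.
Proof. by move=> x; rewrite -[x]qreprK -!iq_piM mul1r. Qed.
Lemma iq_mulr1 : right_id (p 1) iq_mul.
Proof. by move=> x; rewrite -[x]qreprK -!iq_piM mulr1. Qed.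
Lemma iq_mulDl : left_distributive iq_mul +%R.
Proof.
move=> x y z; rewrite -[x]qreprK -[y]qreprK -[z]qreprK.
by rewrite -qpiD -!iq_piM -qpiD mulrDl.
Qed.
Lemma iq_mulDr : right_distributive iq_mul +%R.
Proof.
move=> x y z; rewrite -[x]qreprK -[y]qreprK -[z]qreprK.
by rewrite -qpiD -!iq_piM -qpiD mulrDr.
Qed.
Lemma iq_scalerAl (c : K) (x y : Q) : c *: iq_mul x y = iq_mul (c *: x) y.
Proof.
rewrite -[x]qreprK -[y]qreprK -iq_piM -!(linZ (@qpi_linear _ _ _)) -iq_piM.
by rewrite scalerAl.
Qed.
Lemma iq_scalerAr (c : K) (x y : Q) : c *: iq_mul x y = iq_mul x (c *: y).
Proof.
rewrite -[x]qreprK -[y]qreprK -iq_piM -!(linZ (@qpi_linear _ _ _)) -iq_piM.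
by rewrite scalerAr.
Qed.

End IdealQuotient.

(* The free associative algebra on the set X *)
Definition free_alg (K : fieldType) (X : choiceType) : Type := {malg K[{fmonom X}]}.

HB.instance Definition _ (K : fieldType) (X : choiceType) :=
  GRing.Lalgebra.on (free_alg K X).

Section FreeAlgebra.
Context {K : fieldType} {X : choiceType}.

Fact free_scalerAr (c : K) (x y : free_alg K X) : c *: (x * y) = x * (c *: y).
Proof.
have cE (z : free_alg K X) : c *: z = c%:MP * z by rewrite mul_malgC.
suff H : x * c%:MP = c%:MP * x.
  by rewrite (cE (x * y)) (cE y) (mulrA x) H; exact: mulrA.
rewrite [LHS](malgMEw (fsubset_refl (msupp x)) (msuppC_le c)).
rewrite [RHS](malgMEw (msuppC_le c) (fsubset_refl (msupp x))).
rewrite big_seq_fset1; apply: eq_bigr => k _.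
by rewrite big_seq_fset1 mulm1 mul1m mulrC.
Qed.

HB.instance Definition _ :=
  GRing.Lalgebra_isAlgebra.Build K (free_alg K X) free_scalerAr.

Definition fgen (x : X) : free_alg K X := << fmu x >>.

End FreeAlgebra.

(* In any algebra A, the relations for f : L -> A to be linear and to send    *)
(* the bracket of L to the commutator of A                                    *)
Definition env_rel_for (K : fieldType) (L : lieAlgType K) (A : algType K)
    (f : L -> A) : set A :=
  [set r | (exists (a : K) (x y : L), r = f (a *: x + y) - (a *: f x + f y))
        \/ (exists x y : L, r = f x * f y - f y * f x - f (lie x y))].

Section EnvRel.
Context {K : fieldType} {L : lieAlgType K} {A : algType K} {f : L -> A}.

Lemma env_rel_act0 (V : lmodType K) (t : A -> V -> V) :
  (forall w, linear (t^~ w)) -> (forall a, linear (t a)) ->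
  (forall a b w, t (a * b) w = t a (t b w)) ->
  (forall a x y w, t (f (a *: x + y)) w = a *: t (f x) w + t (f y) w) ->
  (forall x y w, t (f (lie x y)) w = t (f x) (t (f y) w) - t (f y) (t (f x) w)) ->
  forall w z, ideal_gen (env_rel_for f) z -> t z w = 0.
Proof.
move=> tl tr tM flin flie w z [a [r [b [er ->]]]]; rewrite !tM.
suff -> : t r (t b w) = 0 by rewrite (lin0 (tr a)).
have fl := tl (t b w).
case: er => [[c [x [y ->]]]|[x [y ->]]].
  by rewrite (linB fl) fl flin subrr.
by rewrite !(linB fl) !tM flie subrr.
Qed.

Lemma env_rel_mor0 (B : algType K) (t : A -> B) : linear t ->
  (forall a b, t (a * b) = t a * t b) ->
  (forall a x y, t (f (a *: x + y)) = a *: t (f x) + t (f y)) ->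
  (forall x y, t (f (lie x y)) = t (f x) * t (f y) - t (f y) * t (f x)) ->
  forall z, ideal_gen (env_rel_for f) z -> t z = 0.
Proof.
move=> tl tM flin flie z [a [r [b [er ->]]]]; rewrite !tM.
suff -> : t r = 0 by rewrite mulr0 mul0r.
case: er => [[c [x [y ->]]]|[x [y ->]]].
  by rewrite (linB tl) tl flin subrr.
by rewrite !(linB tl) !tM flie subrr.
Qed.

End EnvRel.

Section Enveloping.
Context {K : fieldType} (L : lieAlgType K).

Definition env_rel : set (free_alg K L) := env_rel_for (fgen : L -> free_alg K L).

(* The free algebra on the set L modulo linearity of the generators is the    *)
(* tensor algebra of L, so this is U(L).                                      *)
Definition env : Type := quot (ideal_gen env_rel).

HB.instance Definition _ := GRing.Lmodule.on env.

Definition epi (x : free_alg K L) : env := qpi (ideal_gen env_rel) x.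
Definition erepr (x : env) : free_alg K L := qrepr x.

Lemma ereprK x : epi (erepr x) = x. Proof. exact: qreprK. Qed.
Lemma epi_linear : linear epi. Proof. exact: qpi_linear. Qed.

(* The augmentation U(L) -> K shows that U(L) is not the zero ring. *)
Fact env_one_neq0 : epi 1 != 0.
Proof.
have [e [el eM efg e1]] : exists e : free_alg K L -> K^o,
    [/\ linear e, forall a b, e (a * b) = e a * e b,
        forall x, e (fgen x) = 0 & e 1 = 1].
  exists (fun x : {malg K[{fmonom L}]} => mcoeff (mone : {fmonom L}) x); split.
  - by move=> c x y; rewrite mcoeffD mcoeffZ.
  - by move=> x y; exact: (rmorphM (@mcoeff {fmonom L} K mone)).
  - move=> x; rewrite /fgen mcoeffU1 /= (_ : _ == _ = false) //.
    by apply/negbTE; rewrite fmP fm1 fmuE.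
  - exact: (rmorph1 (@mcoeff {fmonom L} K mone)).
apply/eqP => /qpi_eq0 s1; have : e 1 = 0.
  move: s1; apply: (@span_min _ _ _ [set z | e z = 0]).
    split=> [|a x y /= ex ey]; first exact: (lin0 el).
    by rewrite el ex ey scaler0 addr0.
  apply: (env_rel_mor0 el eM) => [a x y|x y]; rewrite !efg.
    by rewrite scaler0 addr0.
  by rewrite mulr0 subrr.
by rewrite e1; apply/eqP; rewrite oner_eq0.
Qed.

Definition env_mul (x y : env) : env := iq_mul x y.

HB.instance Definition _ := @GRing.Zmodule_isNzRing.Build env (epi 1) env_mul
  (iq_mulA (R := env_rel)) (iq_mul1 (R := env_rel)) (iq_mulr1 (R := env_rel))
  (iq_mulDl (R := env_rel)) (iq_mulDr (R := env_rel)) env_one_neq0.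

HB.instance Definition _ :=
  GRing.Lmodule_isLalgebra.Build K env (iq_scalerAl (R := env_rel)).
HB.instance Definition _ :=
  GRing.Lalgebra_isAlgebra.Build K env (iq_scalerAr (R := env_rel)).

Lemma epiM x y : epi (x * y) = epi x * epi y.
Proof. exact: iq_piM. Qed.

Lemma epi1 : epi 1 = 1. Proof. by []. Qed.

(* The canonical map L -> U(L). *)
Definition env_inj (x : L) : env := epi (fgen x).

Lemma env_inj_linear : linear env_inj.
Proof.
move=> a x y; rewrite /env_inj -epi_linear; apply/qpi_eq; apply: (@ideal_sub _ _ env_rel).
by left; exists a, x, y.
Qed.

Lemma env_inj_lie x y :
  env_inj (lie x y) = env_inj x * env_inj y - env_inj y * env_inj x.
Proof.
rewrite /env_inj -(epiM (fgen x)) -(epiM (fgen y)) -(linB epi_linear).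
by apply/esym/qpi_eq; apply: (@ideal_sub _ _ env_rel); right; exists x, y.
Qed.

End Enveloping.

Section EnvLift.
Context {K : fieldType} {L : lieAlgType K} {A : algType K} (f : L -> A).

Definition free_lift (a : free_alg K L) : A :=
  lin_ext (fun m : {fmonom L} => \prod_(x <- m) f x) a.

(* The algebra map U(L) -> A extending a Lie algebra map f : L -> A. *)
Definition env_lift (a : env L) : A := qlift free_lift a.

Lemma free_liftM a b : free_lift (a * b) = free_lift a * free_lift b.
Proof.
rewrite [a]monalgE [b]monalgE mulr_suml.
have fl : linear free_lift by exact: lin_ext_linear.
rewrite !(lin_sum fl) mulr_suml; apply: eq_bigr => i _.
rewrite mulr_sumr (lin_sum fl) mulr_sumr; apply: eq_bigr => j _.
rewrite [_ * _]fgmulUU /free_lift !lin_extU -scalerAl -scalerAr scalerA.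
by rewrite [mmul _ _]fmmulE big_cat.
Qed.

Lemma free_lift_gen x : free_lift (fgen x) = f x.
Proof. by rewrite /free_lift lin_ext1 fmuE big_seq1. Qed.

Hypothesis f_lin : linear f.
Hypothesis f_lie : forall x y, f (lie x y) = f x * f y - f y * f x.

Lemma free_lift0 z : ideal_gen (env_rel (L := L)) z -> free_lift z = 0.
Proof.
have fl : linear free_lift by exact: lin_ext_linear.
apply: (env_rel_mor0 fl free_liftM) => [a x y|x y].
  by rewrite !free_lift_gen f_lin.
by rewrite !free_lift_gen f_lie.
Qed.

Lemma env_lift_epi a : env_lift (epi a) = free_lift a.
Proof. exact: (qliftE (lin_ext_linear _) free_lift0). Qed.

Lemma env_lift_linear : linear env_lift.
Proof. exact: (qlift_linear (lin_ext_linear _) free_lift0). Qed.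

Lemma env_lift_inj x : env_lift (env_inj x) = f x.
Proof. by rewrite env_lift_epi free_lift_gen. Qed.

Lemma env_liftM a b : env_lift (a * b) = env_lift a * env_lift b.
Proof. by rewrite -[a]ereprK -[b]ereprK -epiM !env_lift_epi free_liftM. Qed.

Lemma env_lift1 : env_lift 1 = 1.
Proof.
rewrite -epi1 env_lift_epi /free_lift [X in lin_ext _ X](_ : 1 = << mone >>) //.
by rewrite lin_ext1 fm1 big_nil.
Qed.

End EnvLift.

Section EnvAct.
Context {K : fieldType} {L : lieAlgType K} {W : lieModType L}.

Definition free_act (a : free_alg K L) (w : W) : W :=
  lin_ext (fun m : {fmonom L} => foldr lact w m) a.

(* A module over L viewed as a left module over U(L). *)
Definition env_act (a : env L) (w : W) : W := qlift (free_act^~ w) a.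

Lemma free_act_linearl w : linear (free_act^~ w).
Proof. exact: lin_ext_linear. Qed.

Lemma free_act_linearr a : linear (free_act a).
Proof.
move=> c v w; rewrite /free_act /lin_ext scaler_sumr -big_split /=.
apply: eq_bigr => m _.
rewrite scalerA mulrC -scalerA -scalerDr; congr (_ *: _).
by elim: (m : seq L) => //= x s ->; rewrite lact_linearr.
Qed.

Lemma free_actM a b w : free_act (a * b) w = free_act a (free_act b w).
Proof.
rewrite [a]monalgE [b]monalgE mulr_suml.
rewrite !(lin_sum (free_act_linearl _)); apply: eq_bigr => i _.
rewrite mulr_sumr !(lin_sum (free_act_linearl _)) (lin_sum (free_act_linearr _)).
apply: eq_bigr => j _; rewrite [_ * _]fgmulUU /free_act !lin_extU.
rewrite -!/(free_act _ _) [mmul _ _]fmmulE foldr_cat -scalerA; congr (_ *: _).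
elim: (i : seq L) => //= x s <-.
by rewrite (linZ (lact_linearr x)).
Qed.

Lemma free_act_gen x w : free_act (fgen x) w = lact x w.
Proof. by rewrite /free_act lin_ext1 fmuE. Qed.

Lemma free_act0 w z : ideal_gen (env_rel (L := L)) z -> free_act z w = 0.
Proof.
apply: (env_rel_act0 free_act_linearl free_act_linearr free_actM) => [a x y v|x y v].
  by rewrite !free_act_gen lact_linearl.
by rewrite !free_act_gen lact_lie.
Qed.

Lemma env_act_epi a w : env_act (epi a) w = free_act a w.
Proof. exact: (qliftE (free_act_linearl w) (@free_act0 w)). Qed.

Lemma env_act_linearl w : linear (env_act^~ w).
Proof. exact: (qlift_linear (free_act_linearl w) (@free_act0 w)). Qed.

Lemma env_act_linearr a : linear (env_act a).
Proof. exact: free_act_linearr. Qed.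

Lemma env_act_inj x w : env_act (env_inj x) w = lact x w.
Proof. by rewrite env_act_epi free_act_gen. Qed.

Lemma env_actM a b w : env_act (a * b) w = env_act a (env_act b w).
Proof. by rewrite -[a]ereprK -[b]ereprK -epiM !env_act_epi free_actM. Qed.

Lemma env_act1 w : env_act 1 w = w.
Proof.
rewrite -epi1 env_act_epi /free_act [X in lin_ext _ X](_ : 1 = << mone >>) //.
by rewrite lin_ext1 fm1.
Qed.

End EnvAct.

Section Tensor.
Context {K : fieldType} {A : Type} {X Y : lmodType K}.
Variables (ra : X -> A -> X) (la : A -> Y -> Y).

Definition pair_gen (x : X) (y : Y) : {malg K[(X * Y)%type]} := << (x, y) >>.

Definition tensor_rel : set {malg K[(X * Y)%type]} :=
  [set r | [\/ exists (c : K) (x x' : X) (y : Y),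
                 r = pair_gen (c *: x + x') y - (c *: pair_gen x y + pair_gen x' y),
               exists (c : K) (x : X) (y y' : Y),
                 r = pair_gen x (c *: y + y') - (c *: pair_gen x y + pair_gen x y')
             | exists (x : X) (a : A) (y : Y),
                 r = pair_gen (ra x a) y - pair_gen x (la a y)]].

(* X (x)_A Y for the right action ra of A on X and the left action la of A on Y *)
Definition tensor : Type := quot tensor_rel.

HB.instance Definition _ := GRing.Lmodule.on tensor.

Definition tens (x : X) (y : Y) : tensor := qpi tensor_rel (pair_gen x y).

Lemma tens_linearl y : linear (tens^~ y).
Proof.
move=> c x x'; rewrite /tens -qpi_linear; apply/qpi_eq; apply: subset_span.
by constructor 1; exists c, x, x', y.
Qed.

Lemma tens_linearr x : linear (tens x).
Proof.
move=> c y y'; rewrite /tens -qpi_linear; apply/qpi_eq; apply: subset_span.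
by constructor 2; exists c, x, y, y'.
Qed.

Lemma tens_balanced x a y : tens (ra x a) y = tens x (la a y).
Proof. by apply/qpi_eq; apply: subset_span; constructor 3; exists x, a, y. Qed.

Lemma eq_tensor_linear (W : lmodType K) (f g : tensor -> W) :
  linear f -> linear g -> (forall x y, f (tens x y) = g (tens x y)) -> f =1 g.
Proof.
move=> lf lg fg z; rewrite -[z]qreprK.
have lc (k : tensor -> W) : linear k -> linear (k \o qpi tensor_rel).
  by move=> lk c x y /=; rewrite qpi_linear lk.
rewrite -[LHS]/((f \o qpi tensor_rel) _) -[RHS]/((g \o qpi tensor_rel) _).
rewrite (linear_malgE (lc f lf)) (linear_malgE (lc g lg)).
by apply: eq_lin_ext => -[x y]; exact: fg.
Qed.

Section Lift.
Variables (W : lmodType K) (b : X -> Y -> W).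
Hypotheses (bl : forall y, linear (b^~ y)) (br : forall x, linear (b x)).
Hypothesis (bA : forall x a y, b (ra x a) y = b x (la a y)).

Definition tensor_lift (z : tensor) : W :=
  qlift (lin_ext (fun p : X * Y => b p.1 p.2)) z.

Lemma tensor_lift0 r : tensor_rel r -> lin_ext (fun p : X * Y => b p.1 p.2) r = 0.
Proof.
have fl := lin_ext_linear (fun p : X * Y => b p.1 p.2).
case=> [[c [x [x' [y ->]]]]|[c [x [y [y' ->]]]]|[x [a [y ->]]]].
- by rewrite (linB fl) fl /pair_gen !lin_ext1 bl subrr.
- by rewrite (linB fl) fl /pair_gen !lin_ext1 br subrr.
- by rewrite (linB fl) /pair_gen !lin_ext1 bA subrr.
Qed.

Lemma tensor_liftE x y : tensor_lift (tens x y) = b x y.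
Proof.
by rewrite [LHS](qliftE (lin_ext_linear _) tensor_lift0) /pair_gen lin_ext1.
Qed.

Lemma tensor_lift_linear : linear tensor_lift.
Proof. exact: (qlift_linear (lin_ext_linear _) tensor_lift0). Qed.

End Lift.
End Tensor.

Section Induced.
Context {K : fieldType} {L : lieAlgType K} (h : lieSubalg L).
Variable Y : lieModType (subLie h).

(* The algebra map U(h) -> U(L) induced by the inclusion of h in L. *)
Definition env_sub : env (subLie h) -> env L :=
  env_lift (fun x : subLie h => env_inj (sublie_val x)).

(* U(L) (x)_{U(h)} Y, on which L acts by left multiplication on U(L) *)
Definition induced : Type :=
  tensor (fun (v : env L) (a : env (subLie h)) => v * env_sub a)
         (@env_act K (subLie h) Y).

HB.instance Definition _ := GRing.Lmodule.on induced.

Definition itens (v : env L) (y : Y) : induced := tens _ _ v y.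

Definition ind_act (g : env L) (z : induced) : induced :=
  tensor_lift (fun (v : env L) (y : Y) => itens (g * v) y) z.

Lemma itens_linearl y : linear (itens^~ y).
Proof. exact: tens_linearl. Qed.

Lemma itens_linearr v : linear (itens v).
Proof. exact: tens_linearr. Qed.

Lemma itens_env_sub v a y : itens (v * env_sub a) y = itens v (env_act a y).
Proof. exact: tens_balanced. Qed.

Let ind_actl (g : env L) y : linear ((fun (v : env L) (y : Y) => itens (g * v) y)^~ y).
Proof. by move=> c v v'; rewrite mulrDr -scalerAr itens_linearl. Qed.

Let ind_actA (g v : env L) a y :
  itens (g * (v * env_sub a)) y = itens (g * v) (env_act a y).
Proof. by rewrite (mulrA g v); exact: itens_env_sub. Qed.

Lemma ind_act_tens g v y : ind_act g (itens v y) = itens (g * v) y.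
Proof.
exact: (tensor_liftE (ind_actl g) (fun v => itens_linearr (g * v)) (@ind_actA g)).
Qed.

Lemma ind_act_linearr g : linear (ind_act g).
Proof.
exact: (tensor_lift_linear (ind_actl g) (fun v => itens_linearr (g * v))
  (@ind_actA g)).
Qed.

Lemma eq_induced (W : lmodType K) (f g : induced -> W) :
  linear f -> linear g -> (forall v y, f (itens v y) = g (itens v y)) -> f =1 g.
Proof. exact: eq_tensor_linear. Qed.

Lemma ind_act_linearl z : linear (ind_act^~ z).
Proof.
move=> c g g'; move: z; apply: eq_induced => [||v y].
- exact: ind_act_linearr.
- exact: (linear_comb c (ind_act_linearr g) (ind_act_linearr g')).
- rewrite (ind_act_tens (c *: g + g')) (ind_act_tens g) (ind_act_tens g').
  by rewrite mulrDl -scalerAl; exact: itens_linearl.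
Qed.

Lemma ind_actM g g' z : ind_act (g * g') z = ind_act g (ind_act g' z).
Proof.
move: z; apply: eq_induced => [||v y].
- exact: ind_act_linearr.
- exact: (linear_comp (ind_act_linearr g) (ind_act_linearr g')).
- rewrite (ind_act_tens (g * g')) (ind_act_tens g') (ind_act_tens g).
  by rewrite mulrA.
Qed.

Lemma ind_actB g g' z : ind_act (g - g') z = ind_act g z - ind_act g' z.
Proof. exact: (linB (ind_act_linearl z)). Qed.

Definition ind_lact (x : L) (z : induced) : induced := ind_act (env_inj x) z.

Fact ind_lact_linearl z : linear (ind_lact^~ z).
Proof. by move=> c x y; rewrite /ind_lact env_inj_linear ind_act_linearl. Qed.

Fact ind_lact_linearr x : linear (ind_lact x).
Proof. exact: ind_act_linearr. Qed.

Fact ind_lact_lie x y z :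
  ind_lact (lie x y) z = ind_lact x (ind_lact y z) - ind_lact y (ind_lact x z).
Proof.
rewrite /ind_lact -(ind_actM (env_inj x)) -(ind_actM (env_inj y)) -ind_actB.
by rewrite env_inj_lie.
Qed.

HB.instance Definition _ := Lmodule_isLieModule.Build K L induced
  ind_lact_linearl ind_lact_linearr ind_lact_lie.

End Induced.

(* Finitely supported matrices indexed by int * int; the entry of x in row m  *)
(* and column n is x@_(m, n).                                                 *)
Definition gl_infty (K : fieldType) : Type := {malg K[(int * int)%type]}.

HB.instance Definition _ (K : fieldType) := GRing.Lmodule.on (gl_infty K).

Lemma commutator_jacobi (K : fieldType) (V : lmodType K) (mu : V -> V -> V) :
  (forall y, linear (mu^~ y)) -> (forall x, linear (mu x)) -> associative mu ->
  let br x y := mu x y - mu y x in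
  forall x y z, br x (br y z) + br y (br z x) + br z (br x y) = 0.
Proof.
move=> ml mr mA br x y z; rewrite /br !(linB (ml _)) !(linB (mr _)) !mA !opprB.
rewrite !addrA [LHS](ACl (1*12*2*7*3*10*4*5*6*11*8*9)%AC) /=.
by rewrite subrr add0r addNr add0r subrr add0r addNr add0r addNr add0r addNr.
Qed.

Section GlInfty.
Context {K : fieldType}.
Local Notation gl := (gl_infty K).

Definition Emx (m n : int) : gl := << (m, n) >>.

(* [E_ij, E_kl] with (i, j) = p and (k, l) = q *)
Definition unit_lie (p q : int * int) : gl :=
  (p.2 == q.1)%:R *: Emx p.1 q.2 - (p.1 == q.2)%:R *: Emx q.1 p.2.

Definition gl_lie (x y : gl) : gl :=
  lin_ext (fun p => lin_ext (fun q => unit_lie p q) y) x.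

Lemma gl_lieE m n r s :
  gl_lie (Emx m n) (Emx r s) = (n == r)%:R *: Emx m s - (m == s)%:R *: Emx r n.
Proof. by rewrite /gl_lie /Emx !lin_ext1. Qed.

Fact gl_lie_linearl y : linear (gl_lie^~ y).
Proof. exact: lin_ext_linear. Qed.

Fact gl_lie_linearr x : linear (gl_lie x).
Proof.
move=> c y z; rewrite /gl_lie /lin_ext scaler_sumr -big_split /=.
apply: eq_bigr => p _; rewrite -/(lin_ext _ _) -/(lin_ext _ _) -/(lin_ext _ _).
by rewrite lin_ext_linear scalerDr !scalerA mulrC.
Qed.

Lemma eq_gl_linear (V : lmodType K) (f g : gl -> V) :
  linear f -> linear g -> (forall m n, f (Emx m n) = g (Emx m n)) -> f =1 g.
Proof.
move=> lf lg fg x; rewrite (linear_malgE lf) (linear_malgE lg).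
by apply: eq_lin_ext => -[m n]; exact: fg.
Qed.

Definition unit_mul (p q : int * int) : gl := (p.2 == q.1)%:R *: Emx p.1 q.2.

Definition gl_mul (x y : gl) : gl :=
  lin_ext (fun p => lin_ext (fun q => unit_mul p q) y) x.

Lemma gl_mulE m n r s : gl_mul (Emx m n) (Emx r s) = (n == r)%:R *: Emx m s.
Proof. by rewrite /gl_mul /Emx !lin_ext1. Qed.

Lemma gl_mul_linearl y : linear (gl_mul^~ y).
Proof. exact: lin_ext_linear. Qed.

Lemma gl_mul_linearr x : linear (gl_mul x).
Proof.
move=> c y z; rewrite /gl_mul /lin_ext scaler_sumr -big_split /=.
apply: eq_bigr => p _; rewrite -/(lin_ext _ _) -/(lin_ext _ _) -/(lin_ext _ _).
by rewrite lin_ext_linear scalerDr !scalerA mulrC.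
Qed.

Lemma gl_mulA x y z : gl_mul x (gl_mul y z) = gl_mul (gl_mul x y) z.
Proof.
move: x; apply: eq_gl_linear => [||m n].
- exact: gl_mul_linearl.
- exact: (linear_comp (gl_mul_linearl z) (gl_mul_linearl y)).
move: y; apply: eq_gl_linear => [||r s].
- exact: (linear_comp (gl_mul_linearr _) (gl_mul_linearl z)).
- exact: (linear_comp (gl_mul_linearl z) (gl_mul_linearr _)).
move: z; apply: eq_gl_linear => [||t u].
- exact: (linear_comp (gl_mul_linearr _) (gl_mul_linearr _)).
- exact: gl_mul_linearr.
rewrite !gl_mulE (linZ (gl_mul_linearr _)) (linZ (gl_mul_linearl _)) !gl_mulE.
by rewrite !scalerA mulrC.
Qed.

Lemma linear_sub (V W : lmodType K) (f g : V -> W) :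
  linear f -> linear g -> linear (fun x => f x - g x).
Proof.
move=> lf lg a x y; rewrite lf lg scalerBr opprD !addrA; congr (_ - _).
by rewrite addrAC.
Qed.

Lemma gl_lie_mul x y : gl_lie x y = gl_mul x y - gl_mul y x.
Proof.
move: x; apply: eq_gl_linear => [||m n].
- exact: gl_lie_linearl.
- exact: (linear_sub (gl_mul_linearl y) (gl_mul_linearr y)).
move: y; apply: eq_gl_linear => [||r s].
- exact: gl_lie_linearr.
- exact: (linear_sub (gl_mul_linearr _) (gl_mul_linearl _)).
by rewrite gl_lieE !gl_mulE (eq_sym s).
Qed.

Fact gl_lie_alt x : gl_lie x x = 0.
Proof. by rewrite gl_lie_mul subrr. Qed.

Fact gl_lie_jacobi x y z :
  gl_lie x (gl_lie y z) + gl_lie y (gl_lie z x) + gl_lie z (gl_lie x y) = 0.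
Proof.
rewrite !gl_lie_mul.
exact: (commutator_jacobi gl_mul_linearl gl_mul_linearr gl_mulA).
Qed.

HB.instance Definition _ := Lmodule_isLieAlgebra.Build K gl
  gl_lie_linearl gl_lie_linearr gl_lie_alt gl_lie_jacobi.

Definition in_category_C (W : lieModType gl) : Prop :=
  forall w : W, exists T : {fset int},
    forall m n : int, n \notin T -> lact (Emx m n) w = 0.

End GlInfty.

Section Subalgebras.
Context {K : fieldType} (S : {fset int}).
Local Notation gl := (gl_infty K).

Definition unitsS : set gl :=
  [set x | exists m n : int, [/\ m \in S, n \in S & x = Emx m n]].
Definition unitsSplus : set gl :=
  [set x | exists m n : int, n \notin S /\ x = Emx m n].

Lemma span_lie (V : lieAlgType K) (A B C : set V) :
  (forall x y, A x -> B y -> span C (lie x y)) ->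
  forall x y, span A x -> span B y -> span C (lie x y).
Proof.
move=> AB x y sx; move: y; have fl := lie_linearr x.
apply: (span_linear fl) => y By; move: x sx {fl}.
by apply: (span_linear (lie_linearl y)) => x Ax; exact: AB.
Qed.

Fact glS_lie x y : span unitsS x -> span unitsS y -> span unitsS (lie x y).
Proof.
apply: span_lie => {x y} _ _ [m [n [mS nS ->]]] [r [s [rS sS ->]]].
rewrite [lie _ _]gl_lieE; apply: spanB; apply: spanZ; apply: subset_span.
  by exists m, s.
by exists r, n.
Qed.

Definition glS : lieSubalg gl :=
  LieSubalg (span_subspace unitsS) glS_lie.

Definition glS_plus : set gl := span unitsSplus.

(* gl_infty^{(S,+)} + gl_S *)
Definition par_set : set gl :=
  [set z | exists x y : gl, [/\ glS_plus x, glS y & z = x + y]].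

Lemma par_setE : par_set = span (unitsSplus `|` unitsS).
Proof.
rewrite eqEsubset; split=> z.
  case=> [x [y [sx sy ->]]]; apply: spanD.
    by apply: span_min sx; [exact: span_subspace | move=> t ut; apply: subset_span; left].
  by apply: span_min sy; [exact: span_subspace | move=> t ut; apply: subset_span; right].
apply: span_min => [|t [ut|ut]].
- split; first by exists 0, 0; split; [exact: span0 | exact: span0 | rewrite addr0].
  move=> a _ _ [x [y [sx sy ->]]] [x' [y' [sx' sy' ->]]].
  exists (a *: x + x'), (a *: y + y'); split; [exact: spanP | exact: spanP |].
  by rewrite scalerDr addrACA.
- by exists t, 0; split; [exact: subset_span | exact: span0 | rewrite addr0].
- by exists 0, t; split; [exact: span0 | exact: subset_span | rewrite add0r].
Qed.

Fact par_subspace : subspace par_set.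
Proof. by rewrite par_setE; exact: span_subspace. Qed.

Lemma unitsP x : (unitsSplus `|` unitsS) x <->
  exists m n : int, ((n \in S) ==> (m \in S)) /\ x = Emx m n.
Proof.
split=> [[[m [n [nS ->]]]|[m [n [mS nS ->]]]]|[m [n [mn ->]]]].
- by exists m, n; rewrite (negbTE nS).
- by exists m, n; rewrite mS implybT.
- have [nS|nS] := boolP (n \in S); last by left; exists m, n.
  by right; exists m, n; rewrite nS (implyP mn nS).
Qed.

Fact par_lie x y : par_set x -> par_set y -> par_set (lie x y).
Proof.
rewrite par_setE; apply: span_lie => {x y} _ _ /unitsP[m [n [mn ->]]] /unitsP[r [s [rs ->]]].
rewrite [lie _ _]gl_lieE; apply: spanB.
  have [nr|nr] := eqVneq n r; last by rewrite scale0r; exact: span0.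
  apply: spanZ; apply: subset_span; apply/unitsP; exists m, s; split=> //.
  by apply/implyP => /(implyP rs); rewrite -nr => /(implyP mn).
have [ms|ms] := eqVneq m s; last by rewrite scale0r; exact: span0.
apply: spanZ; apply: subset_span; apply/unitsP; exists r, n; split=> //.
by apply/implyP => /(implyP mn); rewrite ms => /(implyP rs).
Qed.

Definition par : lieSubalg gl := LieSubalg par_subspace par_lie.

(* The S x S block of a matrix; on gl_infty^{(S,+)} + gl_S this is the        *)
(* projection onto gl_S along gl_infty^{(S,+)}.                               *)
Definition truncS : gl -> gl :=
  lin_ext (fun p => if (p.1 \in S) && (p.2 \in S) then Emx p.1 p.2 else 0).

Lemma truncS_linear : linear truncS.
Proof. exact: lin_ext_linear. Qed.

Lemma truncSE m n : truncS (Emx m n) = if (m \in S) && (n \in S) then Emx m n else 0.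
Proof. exact: lin_ext1. Qed.

Lemma truncS_glS x : glS (truncS x).
Proof.
apply: span_sum => p _; apply: spanZ; case: ifP => [/andP[mS nS]|_]; last exact: span0.
by apply: subset_span; exists p.1, p.2.
Qed.

Lemma truncS_plus x : glS_plus x -> truncS x = 0.
Proof.
apply: (@span_min _ _ _ [set z | truncS z = 0]) => [|_ [m [n [nS ->]]] /=].
  split=> [|a y z /= y0 z0]; first exact: (lin0 truncS_linear).
  by rewrite truncS_linear y0 z0 scaler0 addr0.
by rewrite truncSE (negbTE nS) andbF.
Qed.

Lemma truncS_id x : glS x -> truncS x = x.
Proof.
apply: (eq_linear_span truncS_linear) => // _ [m [n [mS nS ->]]].
by rewrite truncSE mS nS.
Qed.

Lemma truncS_unit_lie m n r s :
  (n \in S) ==> (m \in S) -> (s \in S) ==> (r \in S) ->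
  truncS (lie (Emx m n) (Emx r s)) = lie (truncS (Emx m n)) (truncS (Emx r s)).
Proof.
move=> mn rs; rewrite [lie _ _ in LHS]gl_lieE.
have -> : truncS ((n == r)%:R *: Emx m s - (m == s)%:R *: Emx r n) =
    (n == r)%:R *: truncS (Emx m s) - (m == s)%:R *: truncS (Emx r n).
  rewrite [LHS](linB truncS_linear).
  by congr (_ - _); exact: (linZ truncS_linear).
rewrite (truncSE m s) (truncSE r n) (truncSE m n) (truncSE r s).
have lz z : lie z (0 : gl) = 0 by exact: (lin0 (lie_linearr z)).
have zl z : lie (0 : gl) z = 0 by exact: (lin0 (lie_linearl z)).
have [nS|nS] := boolP (n \in S); have [sS|sS] := boolP (s \in S).
- rewrite (implyP mn nS) (implyP rs sS) /=.
  by rewrite [RHS]gl_lieE.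
- rewrite !andbF lz scaler0 sub0r.
  have [ms|ms] := eqVneq m s; last by rewrite scale0r oppr0.
  by move: (implyP mn nS) sS; rewrite ms => ->.
- rewrite !andbF zl scaler0 subr0.
  have [nr|nr] := eqVneq n r; last by rewrite scale0r.
  by move: (implyP rs sS) nS; rewrite nr => ->.
- by rewrite !andbF zl !scaler0 subr0.
Qed.

Lemma truncS_lie x y : par x -> par y ->
  truncS (lie x y) = lie (truncS x) (truncS y).
Proof.
rewrite /= par_setE => px py.
move: x px; apply: eq_linear_span => [||_ /unitsP[m [n [mn ->]]]].
- exact: (linear_comp truncS_linear (lie_linearl y)).
- exact: (linear_comp (lie_linearl _) truncS_linear).
move: y py; apply: eq_linear_span => [||_ /unitsP[r [s [rs ->]]]].
- exact: (linear_comp truncS_linear (lie_linearr _)).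
- exact: (linear_comp (lie_linearr _) truncS_linear).
exact: truncS_unit_lie.
Qed.

Definition to_glS (x : gl) : subLie glS := SubLie (sublie_mem (truncS_glS x)).

Lemma to_glS_linear : linear to_glS.
Proof.
move=> a x y; apply: val_inj; rewrite [RHS]sublie_val_linear.
exact: truncS_linear.
Qed.

Lemma to_glS_lie (x y : subLie par) :
  to_glS (sublie_val (lie x y)) =
  lie (to_glS (sublie_val x)) (to_glS (sublie_val y)).
Proof. by apply: val_inj; exact: (truncS_lie (sublieP x) (sublieP y)). Qed.

Section ParModule.
Variable U : lieModType (subLie glS).

(* U as a module over gl_infty^{(S,+)} + gl_S, with gl_infty^{(S,+)} acting   *)
(* trivially                                                                  *)
Definition par_mod : Type := U.

HB.instance Definition _ := GRing.Lmodule.on par_mod.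

Definition par_lact (z : subLie par) (u : par_mod) : par_mod :=
  lact (to_glS (sublie_val z)) (u : U).

Fact par_lact_linearl u : linear (par_lact^~ u).
Proof.
by move=> a x y; rewrite /par_lact sublie_val_linear to_glS_linear lact_linearl.
Qed.

Fact par_lact_linearr z : linear (par_lact z).
Proof. exact: lact_linearr. Qed.

Fact par_lact_lie x y u :
  par_lact (lie x y) u = par_lact x (par_lact y u) - par_lact y (par_lact x u).
Proof. by rewrite /par_lact to_glS_lie lact_lie. Qed.

HB.instance Definition _ := Lmodule_isLieModule.Build K (subLie par) par_mod
  par_lact_linearl par_lact_linearr par_lact_lie.

Lemma par_lact_plus (z : subLie par) u : glS_plus (sublie_val z) -> par_lact z u = 0.
Proof.
move=> /truncS_plus z0; rewrite /par_lact (_ : to_glS (sublie_val z) = 0).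
  exact: (lin0 (@lact_linearl _ _ U u)).
by apply: val_inj.
Qed.

Lemma par_lact_glS (z : subLie par) (x : subLie glS) u :
  sublie_val z = sublie_val x -> par_lact z u = lact x (u : U).
Proof.
move=> zx; rewrite /par_lact (_ : to_glS _ = x) //; apply: val_inj => /=.
by rewrite zx truncS_id //; exact: sublieP.
Qed.

Definition M_mod : Type := induced (par_mod : lieModType (subLie par)).

HB.instance Definition _ := LieModule.on M_mod.

(* The degree of Emx m n in the grading of gl_infty determined by S           *)
Definition deg (m n : int) : int :=
  if (m \in S) && (n \notin S) then 1
  else if (m \notin S) && (n \in S) then -1 else 0.

(* The degree d subspace of M(S,U), U being in degree 0                       *)
Definition homog (d : int) : set M_mod :=
  span [set z | exists (s : seq (int * int)) (u : U),
    \sum_(p <- s) deg p.1 p.2 = d /\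
    z = itens (\prod_(p <- s) env_inj (Emx p.1 p.2)) (u : par_mod)].

Definition graded_submodule (N : set M_mod) : Prop :=
  submodule N /\ N `<=` span (\bigcup_(d in [set: int]) (N `&` homog d)).

(* Its span, i.e. the sum of all graded submodules with zero degree 0 part,   *)
(* is the maximal such submodule.                                             *)
Definition deg0_free : set M_mod :=
  \bigcup_(N in [set N | graded_submodule N /\ N `&` homog 0 `<=` [set 0]]) N.

Lemma deg0_free_submodule : submodule (span deg0_free).
Proof.
split=> [|x w]; first exact: span_subspace.
apply: (span_linear (lact_linearr x)) => z [N [[sN gN] N0] Nz].
by apply: subset_span; exists N; [split | exact: sN.2].
Qed.

Definition L_mod : Type := quot deg0_free.

HB.instance Definition _ := GRing.Lmodule.on L_mod.

HB.instance Definition _ := Lmodule_isLieModule.Build K gl L_mod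
  (qlact_linearl deg0_free_submodule) (qlact_linearr deg0_free_submodule)
  (qlact_lie deg0_free_submodule).

End ParModule.
End Subalgebras.

Arguments glS K S : clear implicits.
Arguments M_mod {K} S U.
Arguments L_mod {K} S U.

(* Main.v *)
From HB Require Import structures.
From mathcomp Require Import all_boot all_order all_algebra finmap.
From mathcomp Require Import ring.
From mathcomp Require Import boolp classical_sets reals.
From mathcomp Require Import monalg complex.
Require Import Defs.

(* Since gl_infty contains every E_mm with m outside S, and a sum of enough   *)
(* of them acts on any given vector of M(S,U) as minus the degree, all        *)
(* submodules of M(S,U) are graded.  Hence those meeting U trivially have     *)
(* sum deg0_free, and any nonzero submodule of L(S,U) meets the irreducible   *)
(* generating U.  That 1 (x) u <> 0 follows by mapping M(S,U) to an explicit  *)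
(* module of U-valued polynomials, on which gl_infty acts by first order      *)
(* differential operators.  Conversely, if W is irreducible and in C, the     *)
(* vectors of W killed by all E_mn with n outside a large S form a gl_S-      *)
(* module U <> 0, and the kernel of M(S,U) -> W is graded and meets U         *)
(* trivially, so W is L(S,U); the grading of W also shows U is irreducible.   *)

Set Implicit Arguments.
Unset Strict Implicit.
Unset Printing Implicit Defensive.

Import Order.TTheory GRing.Theory Num.Theory.
Local Open Scope classical_set_scope.
Local Open Scope ring_scope.

(** The grading is forced on every submodule. The sum of all [Emx m m] with m outside S is not in
    gl_infty, but its finite truncations [diag] act on a given vector of degree -k as the scalar k
    once they are large enough. In characteristic 0 every submodule therefore contains the
    components of its vectors ([submodule_graded]), and components are unique ([grade0_component]).

    In M(S,U) it follows that [deg0_free] contains every submodule meeting U trivially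
    ([sub_deg0_free]), and that its span still meets U trivially ([deg0_free_top]). So a nonzero
    submodule of L(S,U) pulls back to one containing a nonzero vector of U, then all of U by
    irreducibility, then everything ([L_irreducible]). That U survives in M(S,U) is [top_eq0]:
    instead of the PBW theorem it uses the action of gl_infty on U-valued polynomials
    ([unit_op_comm]), where 1 (x) u is visibly nonzero. Membership in C spreads from the generators
    ([L_in_category_C]).

    Conversely, a nonzero w in W is singular for some finite S. The singular vectors form U. The
    submodule generated by a nonzero part of U is W, and comparing components of degree 0 shows that
    this part is all of U ([sing_mod_irreducible]). The map from M(S,U) to W given by the universal
    property has kernel exactly the span of [deg0_free] ([singular_iso]). *)

Definition char0 (K : fieldType) := forall n : nat, n.+1%:R != 0 :> K.

(** * Linear algebra: sums of subspaces and eigenvector components *)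

Section Linear.
Context {K : fieldType} {V : lmodType K}.
Implicit Types (N : set V) (B : nat -> set V).

Lemma subspaceZ N a x : subspace N -> N x -> N (a *: x).
Proof. by move=> [N0 NP] Nx; rewrite -[_ *: _]addr0; apply: NP. Qed.

Lemma subspaceD N x y : subspace N -> N x -> N y -> N (x + y).
Proof. by move=> [N0 NP] Nx Ny; rewrite -[x]scale1r; apply: NP. Qed.

Lemma subspaceB N x y : subspace N -> N x -> N y -> N (x - y).
Proof. by move=> [N0 NP] Nx Ny; rewrite addrC -scaleN1r; apply: NP. Qed.

Lemma subspace_sum N (I : Type) (r : seq I) (P : pred I) (F : I -> V) :
  subspace N -> (forall i, P i -> N (F i)) -> N (\sum_(i <- r | P i) F i).
Proof.
move=> sN NF; elim/big_ind : _ => //; first exact: sN.1.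
by move=> x y; exact: subspaceD.
Qed.

Lemma span_id N : subspace N -> span N = N.
Proof.
by move=> sN; apply/seteqP; split=> [x|]; [exact: span_min | exact: subset_span].
Qed.

(** Finite sums of this form are closed under linear combinations once two of them are padded with
    zeros to a common length. *)
Lemma span_bigcup_decomp B z : (forall k, subspace (B k)) ->
  span (\bigcup_k B k) z ->
  exists (n : nat) (g : nat -> V), (forall k, B k (g k)) /\ z = \sum_(k < n) g k.
Proof.
move=> sB; move: z.
suff : subspace [set z | exists (n : nat) (g : nat -> V),
    (forall k, B k (g k)) /\ z = \sum_(k < n) g k].
  move=> sQ z; apply: (span_min sQ) => x [k _ Bx].
  exists k.+1, (fun j => if j == k then x else 0); split=> [j|].
    by case: eqP => [->//|_]; exact: (sB j).1.
  rewrite big_ord_recr /= eqxx big1 ?add0r // => i _.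
  by rewrite ltn_eqF.
split=> [|a x y [n [g [Bg ->]]] [m [h [Bh ->]]]].
  by exists 0%N, (fun=> 0); rewrite big_ord0; split=> // k; exact: (sB k).1.
have pad (p q : nat) (f : nat -> V) : (p <= q)%N ->
    \sum_(k < p) f k = \sum_(k < q) (if (k < p)%N then f k else 0).
  by move=> pq; rewrite (big_ord_widen q f pq) big_mkcond.
exists (maxn n m), (fun k => a *: (if (k < n)%N then g k else 0)
                           + (if (k < m)%N then h k else 0)); split=> [k|].
  apply: (sB k).2; case: ifP => _ //; exact: (sB k).1.
rewrite big_split /= -scaler_sumr -!pad //; [exact: leq_maxr|exact: leq_maxl].
Qed.

(** Applying [f - c n] kills the last eigenvector and scales the others by the nonzero [c k - c n],
    so induction puts those in [N]; the last one is what remains of the sum. *)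
Lemma eigen_components N (f : V -> V) (c : nat -> K) (g : nat -> V) n :
  subspace N -> (forall x, N x -> N (f x)) -> linear f -> injective c ->
  (forall k, (k < n)%N -> f (g k) = c k *: g k) ->
  N (\sum_(k < n) g k) -> forall k, (k < n)%N -> N (g k).
Proof.
move=> sN fN lf ci; elim: n g => [//|n IH] g gE Ns.
have Nlt k : (k < n)%N -> N (g k).
  move=> kn; suff : N ((c k - c n) *: g k).
    move/(subspaceZ (c k - c n)^-1 sN); rewrite scalerA mulVf ?scale1r //.
    by rewrite subr_eq0; apply/eqP => /ci kn'; rewrite kn' ltnn in kn.
  apply: (IH (fun k => (c k - c n) *: g k)) => // [j jn|].
    by rewrite (linZ lf) gE ?(leq_trans jn) // !scalerA mulrC.
  have -> : \sum_(k < n) (c k - c n) *: g k =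
      f (\sum_(k < n.+1) g k) - c n *: \sum_(k < n.+1) g k.
    rewrite (lin_sum lf) scaler_sumr -sumrB big_ord_recr /=.
    rewrite gE // subrr addr0; apply: eq_bigr => i _.
    by rewrite scalerBl gE // ltnW // ltnS.
  by apply: subspaceB => //; [exact: fN | exact: subspaceZ].
move=> k; rewrite ltnS leq_eqVlt => /predU1P[->|]; last exact: Nlt.
move: Ns; rewrite big_ord_recr /= => Ns.
rewrite -[g n](addKr (\sum_(k < n) g k)) addrC; apply: subspaceB => //.
by apply: subspace_sum => // i _; exact: Nlt.
Qed.

End Linear.

Lemma malg_subspace (K : fieldType) (X : choiceType) (Q : set {malg K[X]}) :
  subspace Q -> (forall k, Q << k >>) -> forall p, Q p.
Proof.
move=> sQ QX p; rewrite -(span_id sQ); apply/qpi_eq0.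
rewrite (linear_malgE (@qpi_linear _ _ Q)) /lin_ext big1 // => k _.
suff -> : qpi Q << k >> = 0 by rewrite scaler0.
by apply/qpi_eq0; rewrite span_id.
Qed.

Lemma linear_lie_unit (K : fieldType) (V : lmodType K) (f : gl_infty K -> V)
    (m n r s : int) : linear f ->
  f (lie (Emx m n : gl_infty K) (Emx r s)) =
  (n == r)%:R *: f (Emx m s) - (m == s)%:R *: f (Emx r n).
Proof.
move=> lf; apply: etrans (congr1 f (gl_lieE m n r s)) _.
apply: etrans (linB lf _ _) _.
by congr (_ - _); exact: (linZ lf).
Qed.

(** * Lowering words and their grading *)

Section Words.
Context {K : fieldType} {V : lieModType (gl_infty K)} (S : {fset int}).
Local Notation gl := (gl_infty K).
Implicit Types (s : seq (int * int)) (P N : set V) (d : int) (T : {fset int}).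

Definition word s (v : V) : V := foldr (fun p => lact (Emx p.1 p.2 : gl)) v s.

Definition lowering : pred (int * int) := fun p => (p.1 \notin S) && (p.2 \in S).

Lemma degE (m n : int) : deg S m n = (m \in S)%:Z - (n \in S)%:Z.
Proof. by rewrite /deg; case: (m \in S); case: (n \in S). Qed.

Lemma deg_lowering p : lowering p -> deg S p.1 p.2 = -1.
Proof. by rewrite degE => /andP[/negbTE -> ->]. Qed.

Lemma lact_lieE (x y : gl) (v : V) :
  lact x (lact y v) = lact (lie x y) v + lact y (lact x v).
Proof. by rewrite lact_lie subrK. Qed.

Lemma lact_lie_unit (m n r s : int) (v : V) :
  lact (lie (Emx m n : gl) (Emx r s)) v =
  (n == r)%:R *: lact (Emx m s : gl) v - (m == s)%:R *: lact (Emx r n : gl) v.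
Proof. exact: (linear_lie_unit _ _ _ _ (lact_linearl v)). Qed.

Lemma lact_sub_units N : subspace N ->
  (forall m n v, N v -> N (lact (Emx m n : gl) v)) -> submodule N.
Proof.
move=> sN NE; split=> // x v Nv.
rewrite (linear_malgE (lact_linearl v)); apply: subspace_sum => // p _.
by apply: subspaceZ => //; case: p => m n; exact: NE.
Qed.

(** Only lowering words occur, so nothing nonzero has positive degree; [homogE] matches this with
    [homog], which uses arbitrary words. Leaving [P] free serves both U inside M(S,U) and the
    singular vectors of a module in C. *)
Definition grade P d : set V :=
  span [set z | exists s v,
    [/\ all lowering s, P v, d = - (size s)%:Z & z = word s v]].

Lemma grade_mono P P' d : P `<=` P' -> grade P d `<=` grade P' d.
Proof.
move=> PP'; apply: span_min; first exact: span_subspace.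
by move=> _ [s [v [ls Pv -> ->]]]; apply: subset_span; exists s, v; split=> //; exact: PP'.
Qed.

Lemma grade_word P s v : all lowering s -> P v ->
  grade P (- (size s)%:Z) (word s v).
Proof. by move=> ls Pv; apply: subset_span; exists s, v. Qed.

Lemma lact_lowering_grade P d p z : lowering p -> grade P d z ->
  grade P (d - 1) (lact (Emx p.1 p.2 : gl) z).
Proof.
move=> lp; apply: (span_linear (lact_linearr _)) => _ [s [v [ls Pv -> ->]]].
apply: subset_span; exists (p :: s), v; split=> //=; first by rewrite lp.
by rewrite intS opprD addrC.
Qed.

Variable P : set V.
Hypothesis P_sub : subspace P.
Hypothesis P_plus : forall m n v, n \notin S -> P v -> lact (Emx m n : gl) v = 0.
Hypothesis P_glS : forall m n v, m \in S -> n \in S -> P v ->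
  P (lact (Emx m n : gl) v).

(** Commuting [Emx m n] past the first letter leaves a bracket of matrix units in which degrees add,
    acting on a shorter word. The properties of [P] enter at the empty word. *)
Lemma lact_word_grade s m n v : all lowering s -> P v ->
  grade P (deg S m n - (size s)%:Z) (lact (Emx m n : gl) (word s v)).
Proof.
move=> ls Pv; elim: s ls m n => [_|p s IH /= /andP[lp ls]] m n.
  rewrite subr0 /=; have [nS|nS] := boolP (n \in S); last first.
    by rewrite P_plus //; exact: span0.
  have [mS|mS] := boolP (m \in S).
    rewrite degE nS mS subrr; apply: (@grade_word P [::]) => //; exact: P_glS.
  rewrite degE nS (negbTE mS); apply: (@grade_word P [:: (m, n)]) => //=.
  by rewrite /lowering /= nS mS.
have [p1 p2] := andP lp.
rewrite lact_lieE lact_lie_unit; apply: spanD; last first.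
  rewrite intS opprD addrCA addrC; apply: lact_lowering_grade => //; exact: IH.
apply: spanB.
  have [np|_] := eqVneq n p.1; last by rewrite scale0r; exact: span0.
  apply: spanZ; have := IH ls m p.2; congr (grade P _ _).
  rewrite !degE np (negbTE p1) p2 intS /=; ring.
have [mp|_] := eqVneq m p.2; last by rewrite scale0r; exact: span0.
apply: spanZ; have := IH ls p.1 n; congr (grade P _ _).
rewrite !degE mp (negbTE p1) p2 intS /=; ring.
Qed.

Lemma lact_grade m n d z : grade P d z ->
  grade P (d + deg S m n) (lact (Emx m n : gl) z).
Proof.
apply: (span_linear (lact_linearr _)) => _ [s [v [ls Pv -> ->]]].
by rewrite addrC; exact: lact_word_grade.
Qed.

Lemma word_grade s v : P v ->
  grade P (\sum_(p <- s) deg S p.1 p.2) (word s v).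
Proof.
move=> Pv; elim: s => [|p s IH] /=.
  by rewrite big_nil; exact: (@grade_word P [::]).
by rewrite big_cons addrC; exact: lact_grade.
Qed.

Lemma grade_pos d z : 0 < d -> grade P d z -> z = 0.
Proof.
move=> d0 gz; apply: (@span_min _ _ _ [set 0] _ _ z gz) => [|x [s [v [_ _ dE _]]]].
  by split=> // a _ _ -> ->; rewrite /= scaler0 addr0.
by move: d0; rewrite dE oppr_gt0.
Qed.

Lemma grade0 : grade P 0 = P.
Proof.
rewrite -[RHS]span_id //; congr span; apply/seteqP; split=> [z|z Pz]; last by exists [::], z.
by move=> [[|p s] [v [_ Pv]]] // _ ->.
Qed.

Lemma grades_submodule : submodule (span (\bigcup_k grade P (- k%:Z))).
Proof.
apply: lact_sub_units => [|m n v]; first exact: span_subspace.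
apply: (span_linear (lact_linearr _)) => z [k _ gz].
have := @lact_grade m n _ _ gz.
(* A raising operator on degree 0 would land in positive degree, where the grade is zero. *)
case E : (- k%:Z + deg S m n) => [[|j]|j] gE.
- by apply: subset_span; exists 0%N.
- by rewrite (grade_pos _ gE) //; exact: span0.
- by apply: subset_span; exists j.+1.
Qed.

Lemma P_grades : P `<=` span (\bigcup_k grade P (- k%:Z)).
Proof. by move=> v Pv; apply: subset_span; exists 0%N => //=; rewrite oppr0 grade0. Qed.

(** It kills [P] and has bracket 1 with each lowering unit whose row is in [T], so it counts the
    letters of a lowering word. *)
Definition diag T : gl := \sum_(m <- (T `\` S)%fset) Emx m m.

Lemma lie_diag_lowering T p : lowering p -> p.1 \in T ->
  lie (diag T) (Emx p.1 p.2 : gl) = Emx p.1 p.2.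
Proof.
move=> /andP[p1 p2] pT.
rewrite (lin_sum (lie_linearl _)) (bigD1_seq p.1) ?in_fsetD ?p1 ?fset_uniq //=.
have E m : m \notin S ->
    lie (Emx m m : gl) (Emx p.1 p.2) = (m == p.1)%:R *: Emx m p.2.
  move=> mS; rewrite [lie _ _]gl_lieE (_ : m == p.2 = false) ?scale0r ?subr0 //.
  by apply: contraNF mS => /eqP ->.
rewrite E // eqxx scale1r big1_fset ?addr0 // => m; rewrite in_fsetD => /andP[mS _] mp.
by rewrite E // (negbTE mp) scale0r.
Qed.

Lemma lact_diag_word T s v : all lowering s -> P v ->
  all (fun p => p.1 \in T) s ->
  lact (diag T) (word s v) = (size s)%:R *: word s v.
Proof.
move=> ls Pv; elim: s ls => [_ _|p s IH /= /andP[lp ls] /andP[pT sT]] /=.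
  rewrite scale0r (lin_sum (lact_linearl _)) big1_fset // => m.
  by rewrite in_fsetD => /andP[mS _] _; exact: P_plus.
rewrite lact_lieE lie_diag_lowering // IH // (linZ (lact_linearr _)).
by rewrite -{1}[lact _ _]scale1r -scalerDl -natr1 addrC.
Qed.

Lemma grade_diag (k : nat) z : grade P (- k%:Z) z ->
  exists T0 : {fset int}, forall T, (T0 `<=` T)%fset -> lact (diag T) z = k%:R *: z.
Proof.
apply: (@span_min _ _ _ [set z | exists T0 : {fset int},
   forall T, (T0 `<=` T)%fset -> lact (diag T) z = k%:R *: z]).
  split=> [|a x y [T0 xE] [T1 yE]].
    by exists fset0 => T _; rewrite (lin0 (lact_linearr _)) scaler0.
  exists (T0 `|` T1)%fset => T; rewrite fsubUset => /andP[/xE Tx /yE Ty].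
  by rewrite lact_linearr Tx Ty scalerDr !scalerA mulrC.
move=> x [s [v [ls Pv /eqP]]]; rewrite eqr_opp eqz_nat => /eqP -> ->.
exists (seq_fset tt [seq p.1 | p <- s]) => T /fsubsetP sT.
apply: lact_diag_word => //; apply/allP => p ps; apply: sT.
by rewrite seq_fsetE map_f.
Qed.

Hypothesis K0 : char0 K.

(** One [T0] serves the finitely many components, which become eigenvectors of [diag T0] with
    eigenvalues k, distinct by [K0]. *)
Lemma submodule_graded N (g : nat -> V) n : submodule N ->
  (forall k, grade P (- k%:Z) (g k)) -> N (\sum_(k < n) g k) ->
  forall k, (k < n)%N -> N (g k).
Proof.
move=> [sN NE] gg Ns.
have [T0 T0E] : exists T0 : {fset int}, forall T, (T0 `<=` T)%fset ->
    forall k, (k < n)%N -> lact (diag T) (g k) = k%:R *: g k.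
  elim: n {Ns} => [|n [T0 IH]]; first by exists fset0.
  have [T1 T1E] := grade_diag (gg n); exists (T0 `|` T1)%fset => T.
  rewrite fsubUset => /andP[T0T T1T] k; rewrite ltnS leq_eqVlt => /predU1P[->|].
    exact: T1E.
  exact: IH.
have nat_inj (i j : nat) : (i <= j)%N -> i%:R = j%:R :> K -> i = j.
  move=> ij /eqP; rewrite eq_sym -subr_eq0 -natrB //.
  case E : (j - i)%N => [|e]; last by rewrite (negbTE (K0 e)).
  by move/eqP: E; rewrite subn_eq0 => ji _; apply/eqP; rewrite eqn_leq ij.
apply: (eigen_components sN (NE (diag T0)) (lact_linearr _) _ (T0E T0 (fsubset_refl _))) => //.
move=> i j; case/orP: (leq_total i j) => [|ji /esym]; first exact: nat_inj.
by move/(nat_inj _ _ ji).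
Qed.

Lemma grades_decomp z : span (\bigcup_k grade P (- k%:Z)) z ->
  exists (n : nat) (g : nat -> V), (forall k, grade P (- k%:Z) (g k)) /\
    z = \sum_(k < n.+1) g k.
Proof.
have sB (k : nat) : subspace (grade P (- k%:Z)) by exact: span_subspace.
move=> /(span_bigcup_decomp sB)[n [g [gg ->]]].
exists n, (fun k => if (k < n)%N then g k else 0); split=> [k|].
  by case: ifP => _ //; exact: span0.
rewrite big_ord_recr /= ltnn addr0; apply: eq_bigr => i _.
by rewrite ltn_ord.
Qed.

(** Uniqueness of components is gradedness of the zero submodule: it contains the sum of the family
    [h], which is [g] with [z] subtracted in degree 0, hence also [h 0]. *)
Lemma grade0_component z (g : nat -> V) n : P z ->
  (forall k, grade P (- k%:Z) (g k)) -> z = \sum_(k < n.+1) g k -> z = g 0%N.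
Proof.
move=> Pz gg zE; have sub0 : submodule [set 0 : V].
  split=> [|x _ ->]; last by rewrite /= (lin0 (lact_linearr _)).
  by split=> // a _ _ -> ->; rewrite /= scaler0 addr0.
pose h k := if k is 0%N then g 0%N - z else g k.
suff : [set 0] (h 0%N) by move/eqP; rewrite subr_eq0 => /eqP.
apply: (submodule_graded (n := n.+1) (g := h) sub0) => // [[|k]|]; last 2 first.
- exact: gg.
- rewrite big_ord_recl /= (eq_bigr (fun k : 'I_n => g k.+1)) //.
  by rewrite zE big_ord_recl addrAC subrr.
by apply: spanB; [exact: gg 0%N | rewrite -/(grade P _) oppr0 grade0].
Qed.

End Words.

(** * Derivations of polynomials in infinitely many variables *)

Section Derivations.
Context {K : fieldType} {I : choiceType} {P : comAlgType K}.
Variables (mon : {cmonom I} -> P) (mon_ext : ({cmonom I} -> P) -> P -> P).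
Hypothesis mon1 : mon mone = 1.
Hypothesis monM : forall m1 m2, mon m1 * mon m2 = mon (mmul m1 m2).
Hypothesis mon_subspace : forall Q : set P, subspace Q -> (forall m, Q (mon m)) ->
  forall p, Q p.
Hypothesis mon_ext_linear : forall f, linear (mon_ext f).
Hypothesis mon_extE : forall f m, mon_ext f (mon m) = f m.
Local Notation var i := (mon (ucm i)).

Lemma cm_ext (m1 m2 : {cmonom I}) : (forall i, m1 i = m2 i) -> m1 = m2.
Proof. by move=> e; apply/eqP; exact/cmP. Qed.

Lemma ucm_divcm (m : {cmonom I}) i : m i != 0%N -> mmul (ucm i) (divcm m (ucm i)) = m.
Proof.
move=> mi; apply: cm_ext => j; rewrite cmM divcmE cmU.
case: eqVneq => [<-|_]; last by rewrite subn0.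
by rewrite subnKC // lt0n.
Qed.

Lemma pol_ind (Q : set P) : subspace Q -> Q 1 ->
  (forall i p, Q p -> Q (var i * p)) -> forall p, Q p.
Proof.
move=> sQ Q1 QM; apply: (mon_subspace sQ) => m.
have [n mn] : exists n, mdeg m = n by exists (mdeg m).
elim: n m mn => [m /mdeg_eq0I ->|n IH m mn]; first by rewrite mon1.
have [i mi] : exists i, m i != 0%N.
  have [m0|[i mi]] := fset_0Vmem (finsupp m); last by exists i; rewrite cmE_neq0.
  by move: mn; rewrite mdegE m0 big_seq_fset0.
have mE := ucm_divcm mi.
rewrite -mE -monM; apply: QM; apply: IH; move: mn; rewrite -{1}mE mdegM mdegU.
by rewrite add1n => -[].
Qed.

Variable d : I -> P.

(** The Leibniz rule on a monomial: X^m goes to the sum of the m_i X^(m - e_i) d_i. *)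
Definition der_mon (m : {cmonom I}) : P :=
  \sum_(i <- finsupp m) (m i)%:R *: (mon (divcm m (ucm i)) * d i).

Definition der : P -> P := mon_ext der_mon.

Lemma der_linear : linear der.
Proof. exact: mon_ext_linear. Qed.

Lemma der1 : der 1 = 0.
Proof.
rewrite -mon1 /der mon_extE.
by rewrite /der_mon mdom1 big_seq_fset0.
Qed.

Lemma der_mon_mul i (w m : {cmonom I}) : (forall j, w j = (i == j) + m j)%N ->
  der_mon w = d i * mon m + var i * der_mon m.
Proof.
move=> wE; rewrite /der_mon; pose A := (i |` finsupp m)%fset.
have wid (m' : {cmonom I}) : (finsupp m' `<=` A)%fset ->
    \sum_(j <- finsupp m') (m' j)%:R *: (mon (divcm m' (ucm j)) * d j) =
    \sum_(j <- A) (m' j)%:R *: (mon (divcm m' (ucm j)) * d j).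
  move=> sA; apply: big_fset_incl => // j _.
  by rewrite -cmE_eq0 => /eqP ->; rewrite scale0r.
have wA : (finsupp w `<=` A)%fset.
  apply/fsubsetP => j; rewrite in_fset1U -!cmE_neq0 wE.
  by case: (i =P j) => [->|_]; rewrite ?eqxx // add0n => ->; rewrite orbT.
rewrite (wid w wA) (wid m (fsubsetU1 _ _)) mulr_sumr.
transitivity (\sum_(j <- A) ((j == i)%:R *: (d j * mon m) +
   var i * ((m j)%:R *: (mon (divcm m (ucm j)) * d j)))).
  apply: eq_bigr => j _.
  have -> : (w j)%:R = (j == i)%:R + (m j)%:R :> K by rewrite wE natrD eq_sym.
  rewrite scalerDl; congr (_ + _).
    have [ji|_] := eqVneq j i; last by rewrite !scale0r.
    rewrite mulrC; congr (_ *: (_ * mon _)).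
    by apply: cm_ext => k; rewrite divcmE wE cmU ji addKn.
  (* If m_j = 0 the exponent subtraction in [divcm] truncates, but the coefficient is zero;
     otherwise dividing by X_j commutes with multiplying by X_i. *)
  have [->|mj] := eqVneq (m j) 0%N; first by rewrite !scale0r mulr0.
  rewrite -scalerAr mulrA monM; congr (_ *: (mon _ * _)).
  apply: cm_ext => k.
  rewrite divcmE wE cmM divcmE !cmU addnBA //; case: eqVneq => [<-|_] //.
  by rewrite lt0n.
rewrite big_split /= (bigD1_seq i) ?fset_uniq ?fset1U1 //= eqxx scale1r.
by rewrite big1 ?addr0 // => j /negbTE ->; rewrite scale0r.
Qed.

Lemma der_var i p : der (var i * p) = d i * p + var i * der p.
Proof.
move: p; apply: mon_subspace => [|m].
  split=> [|c x y /= hx hy]; first by rewrite /= (lin0 der_linear) !mulr0 (lin0 der_linear) addr0.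
  rewrite mulrDr -scalerAr !der_linear hx hy !mulrDr -!scalerAr scalerDr.
  by rewrite addrACA.
rewrite /= monM /der !mon_extE; apply: der_mon_mul => j.
by rewrite cmM cmU.
Qed.

End Derivations.

(** An interface to the polynomial ring on [I]: [pa_cst] is the constant coefficient, and [pa_der d]
    the derivation sending the variable i to [d i]. *)
Record polynomial_algebra (K : fieldType) (I : choiceType) := PolynomialAlgebra {
  pa_sort :> comAlgType K;
  pa_var : I -> pa_sort;
  pa_cst : pa_sort -> K^o;
  pa_der : (I -> pa_sort) -> pa_sort -> pa_sort;
  pa_cst_linear : linear pa_cst;
  pa_cst1 : pa_cst 1 = 1;
  pa_ind : forall Q : set pa_sort, subspace Q -> Q 1 ->
    (forall i p, Q p -> Q (pa_var i * p)) -> forall p, Q p;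
  pa_der_linear : forall d, linear (pa_der d);
  pa_der1 : forall d, pa_der d 1 = 0;
  pa_der_var : forall d i p,
    pa_der d (pa_var i * p) = d i * p + pa_var i * pa_der d p
}.

Lemma malg_monM (K : fieldType) (I : choiceType) (m1 m2 : {cmonom I}) :
  << m1 >> * << m2 >> = << mmul m1 m2 >> :> {malg K[{cmonom I}]}.
Proof. by rewrite [LHS]fgmulUU mulr1. Qed.

Lemma polynomial_algebra_exists (K : fieldType) (I : choiceType) :
  inhabited (polynomial_algebra K I).
Proof.
pose P : comAlgType K := {malg K[{cmonom I}]}.
pose mon (m : {cmonom I}) : P := << m >>.
pose me (f : {cmonom I} -> P) : P -> P := lin_ext f.
have me_lin f : linear (me f) by exact: lin_ext_linear.
have meE f m : me f (mon m) = f m by exact: lin_ext1.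
have monM m1 m2 : mon m1 * mon m2 = mon (mmul m1 m2) by exact: malg_monM.
have mon_sub : forall Q : set P, subspace Q -> (forall m, Q (mon m)) -> forall p, Q p.
  exact: malg_subspace.
constructor.
apply: (@PolynomialAlgebra K I P (fun i => mon (ucm i)) (mcoeff mone) (der mon me)).
- by move=> c x y; rewrite mcoeffD mcoeffZ.
- exact: (rmorph1 (@mcoeff {cmonom I} K mone)).
- exact: (pol_ind (erefl : mon mone = 1) monM mon_sub).
- exact: der_linear me_lin.
- exact: (der1 (erefl : mon mone = 1) meE).
- exact: (der_var monM mon_sub me_lin meE).
Qed.

(** * A model of M(S,U) by differential operators *)

Section VectorFields.
Context {K : fieldType} (S : {fset int}) (P : polynomial_algebra K (int * int)%type).
Local Notation ind b := ((b : bool)%:R : P).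

(* coord is a Z x S matrix Y whose S x S block is the identity, and vfield m n *)
(* moves Y by E_nm Y - Y (E_nm Y)_S, which preserves that block.  The          *)
(* transposition and the passage to vector fields both reverse brackets, so    *)
(* E_mn |-> vfield m n is a Lie algebra map.                                   *)
Definition coord (r s : int) : P :=
  if r \in S then ind (r == s) else pa_var P (r, s).

(** The (r, n) entry of 1 - Y pr_S, so that [cocoord r n * coord m s] is the velocity of the entry
    (r, s) of Y. It vanishes for r in S. *)
Definition cocoord (r n : int) : P := ind (r == n) - ind (n \in S) * coord r n.

Definition vfield (m n : int) : P -> P :=
  @pa_der _ _ P (fun rs => cocoord rs.1 n * coord m rs.2).

Lemma vfield_linear m n : linear (vfield m n).
Proof. exact: pa_der_linear. Qed.

Lemma vfield1 m n : vfield m n 1 = 0.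
Proof. exact: pa_der1. Qed.

Lemma ind_scale (b : bool) (p : P) : ind b * p = (b%:R : K) *: p.
Proof. by rewrite -[p in RHS]mul1r scalerAl scaler_nat. Qed.

Lemma vfield_ind m n b p : vfield m n (ind b * p) = ind b * vfield m n p.
Proof. by rewrite !ind_scale (linZ (vfield_linear m n)). Qed.

Lemma vfield_coord m n r s p : vfield m n (coord r s * p) =
  cocoord r n * coord m s * p + coord r s * vfield m n p.
Proof.
rewrite {1 3}/coord; have [rS|rS] := boolP (r \in S); last exact: pa_der_var.
rewrite vfield_ind -[LHS]add0r; congr (_ + _).
suff -> : cocoord r n = 0 by rewrite !mul0r.
rewrite /cocoord /coord rS; have [<-|_] := eqVneq r n; last by rewrite mulr0 subrr.
by rewrite rS mulr1 subrr.
Qed.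

Lemma vfield_cocoord m n r l p : vfield m n (cocoord r l * p) =
  cocoord r l * vfield m n p - ind (l \in S) * cocoord r n * coord m l * p.
Proof.
have -> : cocoord r l * p = ind (r == l) * p - ind (l \in S) * (coord r l * p).
  by rewrite mulrBl mulrA.
rewrite (linB (vfield_linear m n)) !vfield_ind vfield_coord [cocoord r l]/cocoord.
ring.
Qed.

Lemma cocoordE r n : ind (r == n) = cocoord r n + ind (n \in S) * coord r n.
Proof. by rewrite subrK. Qed.

(** A commutator of derivations is a derivation, so the identity propagates from 1 through
    multiplication by variables. *)
Lemma vfield_comm m n k l p :
  vfield m n (vfield k l p) - vfield k l (vfield m n p) =
  ind (n == k) * vfield m l p - ind (m == l) * vfield k n p.
Proof.
have vl := vfield_linear.
move: p; apply: pa_ind => [||[r s] p IH].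
- split=> [|c x y hx hy] /=; first by rewrite !(lin0 (vl _ _)) !mulr0 subrr.
  rewrite !vl opprD addrACA -scalerBr hx hy !mulrDr -!scalerAr.
  by rewrite scalerBr opprD addrACA.
- by rewrite !vfield1 !(lin0 (vl _ _)) !mulr0 subrr.
have D a b q : vfield a b (pa_var P (r, s) * q) =
    cocoord r b * coord a s * q + pa_var P (r, s) * vfield a b q.
  exact: pa_der_var.
rewrite /= in IH *; rewrite !D !(linD (vl _ _)) !D -!mulrA.
rewrite !vfield_cocoord !vfield_coord.
(* Expressing the Kronecker deltas through [cocoord] and [coord] leaves a polynomial identity that
   [ring] can settle. *)
rewrite (eq_sym n k) !cocoordE in IH *.
have {}IH : vfield m n (vfield k l p) = vfield k l (vfield m n p) +
  ((cocoord k n + ind (n \in S) * coord k n) * vfield m l p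
    - (cocoord m l + ind (l \in S) * coord m l) * vfield k n p).
  by rewrite -IH addrC subrK.
rewrite IH; ring.
Qed.

End VectorFields.

Section Model.
Context {K : fieldType} (S : {fset int}) (P : polynomial_algebra K (int * int)%type).
Variables (U : lmodType K) (e : int -> int -> U -> U).
Hypothesis e_linear : forall s n, linear (e s n).
Hypothesis e_comm : forall s n t l u, s \in S -> t \in S ->
  e s n (e t l u) - e t l (e s n u) =
  (n == t)%:R *: e s l u - (s == l)%:R *: e t n u.
Local Notation vfield := (@vfield K S P).
Local Notation coord := (@coord K S P).
Local Notation cocoord := (@cocoord K S P).

(* P (x)_K U, the balancing over unit being void. *)
Definition model : Type :=
  tensor (fun (x : P) (_ : unit) => x) (fun (_ : unit) (u : U) => u).

HB.instance Definition _ := GRing.Lmodule.on model.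

Definition mtens (p : P) (u : U) : model := tens _ _ p u.

Lemma mtens_linearl u : linear (mtens^~ u).
Proof. exact: tens_linearl. Qed.

Lemma mtens_linearr p : linear (mtens p).
Proof. exact: tens_linearr. Qed.

Lemma mtens_lift_exists (W : lmodType K) (b : P -> U -> W) :
  (forall u, linear (b^~ u)) -> (forall p, linear (b p)) ->
  exists f : model -> W, linear f /\ forall p u, f (mtens p u) = b p u.
Proof.
move=> bl br; exists (tensor_lift b); split.
  exact: (@tensor_lift_linear _ _ _ _ (fun x _ => x) (fun _ u => u) _ b bl br).
move=> p u.
exact: (@tensor_liftE _ _ _ _ (fun x _ => x) (fun _ u => u) _ b bl br).
Qed.

(** The sum is the transpose of the block (E_nm Y)_S, the correction in [vfield m n], acting on U
    through [e]. *)
Definition unit_map m n (p : P) (u : U) : model :=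
  mtens (vfield m n p) u + \sum_(s <- S) mtens (coord m s * p) (e s n u).

Definition unit_op m n : model -> model := tensor_lift (unit_map m n).

Lemma unit_map_linearl m n u : linear (unit_map m n ^~ u).
Proof.
move=> c p q; rewrite /unit_map vfield_linear mtens_linearl scalerDr addrACA.
congr (_ + _); rewrite scaler_sumr -big_split; apply: eq_bigr => s _ /=.
by rewrite mulrDr -scalerAr mtens_linearl.
Qed.

Lemma unit_map_linearr m n p : linear (unit_map m n p).
Proof.
move=> c u v; rewrite /unit_map mtens_linearr scalerDr addrACA.
congr (_ + _); rewrite scaler_sumr -big_split; apply: eq_bigr => s _ /=.
by rewrite e_linear mtens_linearr.
Qed.

Lemma unit_op_linear m n : linear (unit_op m n).
Proof.
exact: (@tensor_lift_linear _ _ _ _ (fun x _ => x) (fun _ u => u) _ _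
  (unit_map_linearl m n) (unit_map_linearr m n)).
Qed.

Lemma unit_opE m n p u : unit_op m n (mtens p u) =
  mtens (vfield m n p) u + \sum_(s <- S) mtens (coord m s * p) (e s n u).
Proof.
exact: (@tensor_liftE _ _ _ _ (fun x _ => x) (fun _ u => u) _ _
  (unit_map_linearl m n) (unit_map_linearr m n)).
Qed.

Definition mult m l p u : model := \sum_(s <- S) mtens (coord m s * p) (e s l u).

Lemma mult_linear m l u : linear (fun p => mult m l p u).
Proof.
move=> c p q; rewrite /mult scaler_sumr -big_split; apply: eq_bigr => s _ /=.
by rewrite mulrDr -scalerAr mtens_linearl.
Qed.

Lemma sum_ind (F : int -> model) n :
  \sum_(t <- S) (n == t)%:R *: F t = (n \in S)%:R *: F n.
Proof.
have [nS|nS] := boolP (n \in S).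
  rewrite (bigD1_seq n) ?fset_uniq //= eqxx big1 ?addr0 // => t.
  by rewrite eq_sym => /negbTE ->; rewrite scale0r.
rewrite scale0r big_seq big1 // => t tS.
by have [nt|_] := eqVneq n t; [rewrite nt tS in nS | rewrite scale0r].
Qed.

Lemma unit_op2 m n k l p u : unit_op m n (unit_op k l (mtens p u)) =
  mtens (vfield m n (vfield k l p)) u
  + (mult m n (vfield k l p) u + mult k l (vfield m n p) u)
  + (mult m l (cocoord k n * p) u
     + \sum_(t <- S) \sum_(s <- S)
         mtens (coord m s * (coord k t * p)) (e s n (e t l u))).
Proof.
have lu := unit_op_linear m n.
rewrite unit_opE (linD lu) unit_opE (lin_sum lu) -!addrA; congr (_ + (_ + _)).
rewrite /mult -!big_split; apply: eq_bigr => t _ /=.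
have zy : cocoord k n * coord m t * p = coord m t * (cocoord k n * p).
  by rewrite mulrCA mulrA.
rewrite unit_opE vfield_coord zy (linD (mtens_linearl _)) [in RHS]addrA.
by congr (_ + _); rewrite addrC.
Qed.

Lemma sum_comm m n k l p u :
  \sum_(t <- S) \sum_(s <- S)
     mtens (coord m s * (coord k t * p)) (e s n (e t l u))
  - \sum_(t <- S) \sum_(s <- S)
     mtens (coord k s * (coord m t * p)) (e s l (e t n u)) =
  (n \in S)%:R *: mult m l (coord k n * p) u
  - (l \in S)%:R *: mult k n (coord m l * p) u.
Proof.
rewrite [X in _ - X]exchange_big -sumrB.
rewrite -(sum_ind (fun t => mult m l (coord k t * p) u)).
rewrite -(sum_ind (fun t => mult k n (coord m t * p) u)).
under [X in _ - X]eq_bigr do rewrite scaler_sumr.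
rewrite [X in _ - X]exchange_big -sumrB; apply: eq_big_seq => t tS /=.
rewrite scaler_sumr -!sumrB; apply: eq_big_seq => s sS /=.
rewrite [coord k t * (coord m s * p)]mulrCA.
rewrite -(linB (mtens_linearr _)) e_comm // (linB (mtens_linearr _)).
by rewrite !(linZ (mtens_linearr _)) (eq_sym l).
Qed.

(** The [cocoord] term comes from differentiating [coord], the other from the commutator in U;
    together they restore the delta of the bracket in gl_infty. *)
Lemma mult_cocoord m l k n p u :
  mult m l (cocoord k n * p) u + (n \in S)%:R *: mult m l (coord k n * p) u =
  (n == k)%:R *: mult m l p u.
Proof.
rewrite -!(linZ (mult_linear _ _ _)) -(linD (mult_linear _ _ _)).
by rewrite -!ind_scale mulrA -mulrDl -cocoordE eq_sym.
Qed.

Lemma subr_three (V : zmodType) (a a' b b' c c' d d' : V) :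
  a + (b + b') + (c + d) - (a' + (b' + b) + (c' + d')) =
  (a - a') + ((c - c') + (d - d')).
Proof.
have dif (x x' y y' : V) : x + y - (x' + y') = (x - x') + (y - y').
  by rewrite opprD addrACA.
by rewrite dif (dif a) (dif c) [b' + b]addrC subrr addr0.
Qed.

(** In the commutator the mixed terms cancel by symmetry ([subr_three]). The vector fields
    contribute [vfield_comm], and the remaining terms pair up under [mult_cocoord]. *)
Lemma unit_op_comm m n k l z :
  unit_op m n (unit_op k l z) - unit_op k l (unit_op m n z) =
  (n == k)%:R *: unit_op m l z - (m == l)%:R *: unit_op k n z.
Proof.
have lu := unit_op_linear.
move: z; apply: eq_tensor_linear => [||p u].
- by apply: linear_sub; apply: linear_comp; exact: lu.
- by apply: linear_sub => c x y; rewrite lu scalerDr !scalerA mulrC.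
rewrite -/(mtens p u) !unit_op2 !unit_opE -!/(mult _ _ _ _) subr_three sum_comm.
rewrite -(linB (mtens_linearl _)) vfield_comm !ind_scale.
rewrite (linB (mtens_linearl _)) !(linZ (mtens_linearl _)) !scalerDr.
rewrite [X in _ + X]addrACA -opprD !mult_cocoord (eq_sym l).
by rewrite opprD addrACA.
Qed.

End Model.

(** * The module M(S,U) *)

Section EnvInd.
Context {K : fieldType} {L : lieAlgType K}.

Lemma env_ind (Q : set (env L)) : subspace Q -> Q 1 ->
  (forall x a, Q a -> Q (env_inj x * a)) -> forall a, Q a.
Proof.
move=> sQ Q1 QM a; rewrite -[a]ereprK.
rewrite (linear_malgE (@epi_linear _ L)); apply: subspace_sum => // m _.
apply: subspaceZ => //; rewrite -[m]fmK; elim: (m : seq L) => {m} [|x s IH].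
  by rewrite -fmoneE.
suff -> : epi (<< FMonom (x :: s) >> : free_alg K L) =
          env_inj x * epi (<< FMonom s >> : free_alg K L) by exact: QM.
rewrite -epiM; congr epi; rewrite [RHS]fgmulUU mulr1; congr (<< _ >>).
by rewrite [mmul _ _]fmmulE fmuE.
Qed.

End EnvInd.

Section EnvSub.
Context {K : fieldType} {L : lieAlgType K} (h : lieSubalg L).

Let inc_lin : linear (fun x : subLie h => env_inj (sublie_val x)).
Proof. by move=> a x y; rewrite sublie_val_linear env_inj_linear. Qed.

Let inc_lie (x y : subLie h) : env_inj (sublie_val (lie x y)) =
  env_inj (sublie_val x) * env_inj (sublie_val y)
  - env_inj (sublie_val y) * env_inj (sublie_val x).
Proof. exact: env_inj_lie. Qed.

Lemma env_sub_linear : linear (@env_sub K L h).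
Proof. exact: (env_lift_linear inc_lin inc_lie). Qed.

Lemma env_subM a b : env_sub (h := h) (a * b) = env_sub a * env_sub b.
Proof. exact: (env_liftM inc_lin inc_lie). Qed.

Lemma env_sub1 : env_sub (h := h) 1 = 1.
Proof. exact: (env_lift1 inc_lin inc_lie). Qed.

Lemma env_sub_inj (z : subLie h) : env_sub (env_inj z) = env_inj (sublie_val z).
Proof. exact: (env_lift_inj inc_lin inc_lie). Qed.

End EnvSub.

Section Verma.
Context {K : fieldType} (S : {fset int}) (U : lieModType (subLie (glS K S))).
Local Notation gl := (gl_infty K).
Local Notation M := (M_mod S U).

Definition top (u : U) : M := itens (h := par S) (Y := par_mod U) 1 u.

Lemma lact_itens (x : gl) (v : env gl) (u : par_mod U) :
  lact x (itens (h := par S) v u : M) = itens (h := par S) (env_inj x * v) u.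
Proof. exact: (@ind_act_tens K gl (par S) (par_mod U) (env_inj x) v u). Qed.

Lemma top_linear : linear top.
Proof. exact: (@itens_linearr K gl (par S) (par_mod U) 1). Qed.

Lemma lact_par_top (z : subLie (par S)) u :
  lact (sublie_val z) (top u) = top (lact (to_glS S (sublie_val z)) u).
Proof.
rewrite [LHS]lact_itens mulr1 -[env_inj _]mul1r -env_sub_inj itens_env_sub.
by rewrite env_act_inj.
Qed.

Lemma par_unit m n : (n \in S) ==> (m \in S) -> par S (Emx m n : gl).
Proof.
by move=> mn; rewrite /= par_setE; apply: subset_span; apply/unitsP; exists m, n.
Qed.

Lemma lact_unit_top m n u : (n \in S) ==> (m \in S) ->
  lact (Emx m n : gl) (top u) = top (lact (to_glS S (Emx m n : gl)) u).
Proof. by move=> mn; exact: (lact_par_top (SubLie (sublie_mem (par_unit mn)))). Qed.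

Lemma to_glS_plus m n : n \notin S -> to_glS S (Emx m n : gl) = 0.
Proof. by move=> nS; apply: val_inj; rewrite /= truncSE (negbTE nS) andbF. Qed.

Lemma lact_glS_top (x : subLie (glS K S)) u :
  lact (sublie_val x) (top u) = top (lact x u).
Proof.
have px : par S (sublie_val x).
  by exists 0, (sublie_val x); split; [exact: span0|exact: sublieP|rewrite add0r].
have <- : to_glS S (sublie_val x) = x.
  by apply: val_inj; rewrite /= truncS_id //; exact: sublieP.
rewrite /= truncS_id; last exact: sublieP.
exact: (lact_par_top (SubLie (sublie_mem px))).
Qed.

Lemma range_top_subspace : subspace (range top).
Proof.
split; first by exists 0 => //; exact: (lin0 top_linear).
by move=> a _ _ [u _ <-] [v _ <-]; exists (a *: u + v) => //; exact: top_linear.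
Qed.

Lemma range_top_plus m n v : n \notin S -> range top v -> lact (Emx m n : gl) v = 0.
Proof.
move=> nS [u _ <-]; rewrite lact_unit_top ?(negbTE nS) // to_glS_plus //.
by rewrite (lin0 (lact_linearl _)) (lin0 top_linear).
Qed.

Lemma range_top_glS m n v : m \in S -> n \in S -> range top v ->
  range top (lact (Emx m n : gl) v).
Proof.
move=> mS nS [u _ <-]; rewrite lact_unit_top ?mS ?implybT //.
Qed.

Lemma submodule_ind_act (N : set M) (a : env gl) (z : M) : submodule N -> N z ->
  N (ind_act (h := par S) (Y := par_mod U) a z).
Proof.
move=> [sN NE] Nz; move: a; apply: env_ind => [||x a Na].
- split=> [|c a b Na Nb].
    exact: (eq_ind_r N sN.1 (lin0 (@ind_act_linearl K gl (par S) (par_mod U) z))).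
  exact: (eq_ind_r N (sN.2 c _ _ Na Nb)
    (@ind_act_linearl K gl (par S) (par_mod U) z c a b)).
- suff -> : ind_act (h := par S) (Y := par_mod U) 1 z = z by [].
  move: z {Nz}; apply: eq_induced => [||v y]; [exact: ind_act_linearr|by []|].
  by rewrite ind_act_tens mul1r.
- by rewrite ind_actM; exact: NE.
Qed.

Lemma top_generates (N : set M) : submodule N -> (forall u, N (top u)) ->
  forall z, N z.
Proof.
move=> sN Nt z.
suff : qpi N z = 0 by move/qpi_eq0; rewrite span_id //; exact: sN.1.
move: z; apply: (@eq_induced _ _ _ _ _ (qpi N) (fun=> 0)) => [||v y].
- exact: qpi_linear.
- by move=> a x y; rewrite scaler0 addr0.
- apply/qpi_eq0; rewrite span_id; last exact: sN.1.
  have := submodule_ind_act v sN (Nt y).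
  by rewrite ind_act_tens mulr1.
Qed.

Lemma word_top s u : word s (top u) =
  itens (h := par S) (Y := par_mod U)
    (\prod_(p <- s) env_inj (Emx p.1 p.2 : gl)) u.
Proof.
elim: s => [|p s IH]; first by rewrite big_nil.
rewrite big_cons.
exact: (etrans (congr1 (lact (Emx p.1 p.2 : gl)) IH) (lact_itens _ _ _)).
Qed.

(** By [word_grade], a word of total degree d applied to U rewrites into lowering words of the same
    degree. *)
Lemma homogE d : homog (S := S) (U := U) d = grade S (range top) d.
Proof.
apply/seteqP; split; apply: span_min; try exact: span_subspace.
  move=> _ [s [u [<- ->]]]; rewrite -word_top; apply: word_grade.
  - exact: range_top_plus.
  - exact: range_top_glS.
  - by exists u.
move=> _ [s [_ [ls [u _ <-] -> ->]]]; apply: subset_span; exists s, u.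
split; last exact: word_top.
elim: s ls => [_|p s IH /= /andP[lp /IH sE]]; first by rewrite big_nil.
by rewrite big_cons sE deg_lowering // intS opprD.
Qed.

Lemma grades_full (z : M) : span (\bigcup_k grade S (range top) (- k%:Z)) z.
Proof.
apply: top_generates z => [|u].
  apply: grades_submodule; [exact: range_top_plus|exact: range_top_glS].
by apply: P_grades; [exact: range_top_subspace|exists u].
Qed.

Hypothesis K0 : char0 K.

Lemma submodule_is_graded (N : set M) : submodule N -> graded_submodule N.
Proof.
move=> sN; split=> // z Nz.
have [n [g [gg zE]]] := grades_decomp (grades_full z).
rewrite zE; apply: span_sum => k _; apply: subset_span.
exists (- k%:Z) => //; split; last by rewrite homogE.
apply: (submodule_graded range_top_plus K0 sN gg _ (ltn_ord k)).
by rewrite -zE.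
Qed.

Lemma homog0 : homog (S := S) (U := U) 0 = range top.
Proof. by rewrite homogE grade0 //; exact: range_top_subspace. Qed.

Lemma sub_deg0_free (N : set M) : submodule N -> N `&` range top `<=` [set 0] ->
  N `<=` deg0_free (U := U).
Proof.
move=> sN N0 z Nz; exists N => //; split; first exact: submodule_is_graded.
by rewrite homog0.
Qed.

Lemma deg0_free_top u : span (deg0_free (U := U)) (top u) -> top u = 0.
Proof.
(* [B] is the grading with degree 0 emptied. Each submodule in the union is graded with zero degree
   0 part, so it lies in the sum of the [B k]; uniqueness of the degree 0 component then gives the
   claim. *)
pose B (k : nat) := if k is 0%N then [set 0] else grade S (range top) (- k%:Z).
have sB k : subspace (B k).
  case: k => [|k]; last exact: span_subspace.
  by split=> // a _ _ -> ->; rewrite /= scaler0 addr0.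
have BG k : B k `<=` grade S (range top) (- k%:Z).
  by case: k => [|k] // _ ->; exact: span0.
suff sub : span (deg0_free (U := U)) `<=` span (\bigcup_k B k).
  move=> /sub /(span_bigcup_decomp sB)[[|n] [g [Bg tE]]].
    by rewrite tE big_ord0.
  have tu : range top (top u) by exists u.
  have gB k : grade S (range top) (- k%:Z) (g k) by exact: BG.
  rewrite (grade0_component range_top_subspace range_top_plus K0 tu gB tE).
  exact: (Bg 0%N).
apply: span_min => [|z [N [[sN _] N0] Nz]]; first exact: span_subspace.
have [n [g [gg zE]]] := grades_decomp (grades_full z).
rewrite zE; apply: span_sum => k _; apply: subset_span; exists k => //.
have Ng : N (g k).
  apply: (submodule_graded range_top_plus K0 sN gg _ (ltn_ord k)).
  by rewrite -zE.
move: Ng (gg k); case: (k : nat) => [|j] //= Ng g0.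
by apply: N0; split=> //; rewrite homogE -oppr0.
Qed.

End Verma.

(** * The universal property of M(S,U) *)

Section Universal.
Context {K : fieldType} (S : {fset int}) (U : lieModType (subLie (glS K S))).
Local Notation gl := (gl_infty K).
Local Notation M := (M_mod S U).
Variables (V : lieModType gl) (j : U -> V).
Hypothesis j_lin : linear j.
Hypothesis j_plus : forall m n u, n \notin S -> lact (Emx m n : gl) (j u) = 0.
Hypothesis j_glS : forall m n u, m \in S -> n \in S ->
  lact (Emx m n : gl) (j u) = j (lact (to_glS S (Emx m n : gl)) u).

Lemma lact_par_map (x : gl) u : par S x -> lact x (j u) = j (lact (to_glS S x) u).
Proof.
rewrite /= par_setE; move: x; apply: (@eq_linear_span _ _ _ _ (lact^~ (j u))
  (fun x => j (lact (to_glS S x) u))) => [||_ /unitsP[m [n [mn ->]]]].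
- exact: lact_linearl.
- by move=> a y z; rewrite to_glS_linear lact_linearl j_lin.
have [nS|nS] := boolP (n \in S); first by apply: j_glS; rewrite ?(implyP mn).
by rewrite j_plus // to_glS_plus // (lin0 (lact_linearl _)) (lin0 j_lin).
Qed.

(** This is the balancing over U(par) that lets [verma_map] descend to the tensor product. *)
Lemma env_act_par_map (a : env (subLie (par S))) u :
  env_act (env_sub a) (j u) = j (env_act (W := par_mod U) a u).
Proof.
move: u; pattern a; move: a; apply: env_ind => [||x a IH u].
- split=> [u|c a b IHa IHb u].
    by rewrite (lin0 (@env_sub_linear _ _ _)) !(lin0 (env_act_linearl _)) (lin0 j_lin).
  by rewrite env_sub_linear !env_act_linearl j_lin -IHa -IHb.
- by move=> u; rewrite env_sub1 !env_act1.
- rewrite env_subM env_sub_inj !env_actM IH !env_act_inj.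
  by rewrite lact_par_map //; exact: sublieP.
Qed.

Definition verma_map (z : M) : V :=
  tensor_lift (fun (v : env gl) (u : par_mod U) => env_act v (j u)) z.

Let map_l (u : par_mod U) : linear (fun v : env gl => env_act v (j u)).
Proof. exact: env_act_linearl. Qed.

Let map_r (v : env gl) : linear (fun u : par_mod U => env_act v (j u)).
Proof. exact: (linear_comp (env_act_linearr v) j_lin). Qed.

Let map_A (v : env gl) a (u : par_mod U) :
  env_act (v * env_sub a) (j u) = env_act v (j (env_act a u)).
Proof. by rewrite env_actM env_act_par_map. Qed.

Lemma verma_map_linear : linear verma_map.
Proof. exact: (tensor_lift_linear map_l map_r map_A). Qed.

Lemma verma_map_itens v u :
  verma_map (itens (h := par S) (Y := par_mod U) v u) = env_act v (j u).
Proof. exact: (tensor_liftE map_l map_r map_A). Qed.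

Lemma verma_map_top u : verma_map (top u) = j u.
Proof. by rewrite verma_map_itens env_act1. Qed.

Lemma verma_map_lact x z : verma_map (lact x z) = lact x (verma_map z).
Proof.
move: z; apply: eq_induced => [||v u].
- exact: (linear_comp verma_map_linear (lact_linearr _)).
- exact: (linear_comp (lact_linearr _) verma_map_linear).
apply: (etrans (congr1 verma_map (lact_itens x v u))).
apply: (etrans (verma_map_itens _ _)); rewrite env_actM env_act_inj.
exact: (congr1 (lact x) (esym (verma_map_itens v u))).
Qed.

End Universal.

(** The action extends linearly from matrix units. The module [W] is [V] itself and [i] is the
    identity. *)
Lemma gl_rep_exists (K : fieldType) (V : lmodType K) (op : int -> int -> V -> V) :
  (forall m n, linear (op m n)) ->
  (forall m n k l v, op m n (op k l v) - op k l (op m n v) =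
    (n == k)%:R *: op m l v - (m == l)%:R *: op k n v) ->
  exists (W : lieModType (gl_infty K)) (i : V -> W),
    [/\ linear i, injective i &
        forall m n v, lact (Emx m n : gl_infty K) (i v) = i (op m n v)].
Proof.
move=> op_lin op_comm.
have [act [act_linl act_linr actE]] : exists act : gl_infty K -> V -> V,
    [/\ forall v, linear (act^~ v), forall x, linear (act x) &
        forall m n v, act (Emx m n) v = op m n v].
  exists (fun x v => lin_ext (fun p => op p.1 p.2 v) x).
  split=> [v|x|m n v]; [exact: lin_ext_linear| |exact: lin_ext1].
  move=> c v w; rewrite /lin_ext scaler_sumr -big_split /=.
  by apply: eq_bigr => p _; rewrite op_lin scalerDr !scalerA mulrC.
have act_lie x y v : act (lie x y) v = act x (act y v) - act y (act x v).
  move: x; apply: eq_gl_linear => [||m n].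
  - exact: (linear_comp (act_linl v) (lie_linearl y)).
  - apply: linear_sub; first exact: act_linl.
    exact: (linear_comp (act_linr y) (act_linl v)).
  move: y; apply: eq_gl_linear => [||k l].
  - exact: (linear_comp (act_linl v) (lie_linearr _)).
  - apply: linear_sub; last exact: act_linl.
    exact: (linear_comp (act_linr _) (act_linl v)).
  apply: etrans (linear_lie_unit _ _ _ _ (act_linl v)) _.
  apply: etrans (congr2 (fun a b => (n == k)%:R *: a - (m == l)%:R *: b)
    (actE m l v) (actE k n v)) _.
  apply: etrans (esym (op_comm m n k l v)) _.
  have aa a b c d : op a b (op c d v) = act (Emx a b) (act (Emx c d) v).
    exact: etrans (congr1 (op a b) (esym (actE c d v))) (esym (actE a b _)).
  exact: (congr2 (fun a b => a - b) (aa m n k l) (aa k l m n)).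
pose W : lieModType (gl_infty K) := HB.pack V
  (Lmodule_isLieModule.Build K (gl_infty K) V act_linl act_linr act_lie).
by exists W, (id : V -> W); split=> // m n v; exact: actE.
Qed.

(** * U embeds in M(S,U) *)

Section TopInjective.
Context {K : fieldType} (S : {fset int}) (U : lieModType (subLie (glS K S))).
Local Notation gl := (gl_infty K).

Definition glS_op (s n : int) (u : U) : U := lact (to_glS S (Emx s n : gl)) u.

(** [to_glS] respects brackets on [par S], which contains every unit with row in S. *)
Lemma glS_op_comm s n t l u : s \in S -> t \in S ->
  glS_op s n (glS_op t l u) - glS_op t l (glS_op s n u) =
  (n == t)%:R *: glS_op s l u - (s == l)%:R *: glS_op t n u.
Proof.
move=> sS tS; rewrite /glS_op -lact_lie.
have ps : par S (Emx s n : gl) by apply: par_unit; rewrite sS implybT.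
have pt : par S (Emx t l : gl) by apply: par_unit; rewrite tS implybT.
have := to_glS_lie (SubLie (sublie_mem ps)) (SubLie (sublie_mem pt)).
move=> /= <-.
exact: (linear_lie_unit _ _ _ _ (linear_comp (lact_linearl u) (@to_glS_linear _ S))).
Qed.

Lemma top_eq0 (u : U) : top u = 0 -> u = 0.
Proof.
have [P] := polynomial_algebra_exists K (int * int)%type.
have op_lin s n : linear (glS_op s n) by exact: lact_linearr.
have [W [i [i_lin i_inj iE]]] :=
  gl_rep_exists (unit_op_linear (P := P) S op_lin)
    (unit_op_comm (P := P) op_lin glS_op_comm).
pose j u := i (mtens (P := P) 1 u).
have j_lin : linear j by exact: (linear_comp i_lin (mtens_linearr 1)).
have op1 m n v : unit_op S glS_op m n (mtens (P := P) 1 v) =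
    \sum_(s <- S) mtens (coord S P m s) (glS_op s n v).
  rewrite (unit_opE S op_lin) vfield1 (lin0 (mtens_linearl _)) add0r.
  by apply: eq_bigr => s _; rewrite mulr1.
have j_plus m n v : n \notin S -> lact (Emx m n : gl) (j v) = 0.
  move=> nS; rewrite iE op1 big1 ?(lin0 i_lin) // => s _.
  rewrite /glS_op to_glS_plus // (lin0 (lact_linearl _)).
  exact: (lin0 (mtens_linearr _)).
(* For m in S the coordinate row m is a row of the identity matrix, so one summand survives. *)
have j_glS m n v : m \in S -> n \in S ->
    lact (Emx m n : gl) (j v) = j (lact (to_glS S (Emx m n : gl)) v).
  move=> mS nS; rewrite iE op1; congr i.
  rewrite (bigD1_seq m) ?fset_uniq //= big1 ?addr0 => [|s sm].
    by rewrite /coord mS eqxx.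
  by rewrite /coord mS eq_sym (negbTE sm); exact: (lin0 (mtens_linearl _)).
move=> u0; have : j u = 0.
  rewrite -(verma_map_top j_lin j_plus j_glS) u0.
  exact: (lin0 (verma_map_linear j_lin j_plus j_glS)).
rewrite -(lin0 i_lin) => /i_inj ju0.
(* Taking the constant coefficient recovers [u] from 1 (x) u. *)
have [f [f_lin fE]] : exists f : model P U -> U,
    linear f /\ forall p u, f (mtens p u) = (pa_cst p : K) *: u.
  apply: mtens_lift_exists => [v|p] c x y.
    by rewrite pa_cst_linear scalerDl scalerA.
  by rewrite scalerDr !scalerA mulrC.
have := fE 1 u; rewrite ju0 (lin0 f_lin) pa_cst1 => e.
exact: (etrans (esym (scale1r u)) (esym e)).
Qed.

End TopInjective.

(** * The quotient L(S,U) *)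

Section SimpleQuotient.
Context {K : fieldType} (S : {fset int}) (U : lieModType (subLie (glS K S))).
Local Notation gl := (gl_infty K).
Local Notation M := (M_mod S U).

Lemma lact_qpi x (z : M) :
  lact x (qpi (deg0_free (U := U)) z : L_mod S U) = qpi _ (lact x z) :> L_mod S U.
Proof. exact: (qlactE (deg0_free_submodule U)). Qed.

(** Vectors killed by all columns outside a finite set form a submodule [F M]; it contains U, with
    [T := S], hence is all of M(S,U), and the property passes to quotients. *)
Lemma L_in_category_C : in_category_C (L_mod S U).
Proof.
pose F (V : lieModType gl) : set V := [set w | exists T : {fset int},
  forall m n : int, n \notin T -> lact (Emx m n : gl) w = 0].
have FM : submodule (F M).
  apply: lact_sub_units => [|r s w [T wT]].
    split; first by exists fset0 => m n _; exact: (lin0 (lact_linearr _)).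
    move=> a x y [T xT] [T' yT']; exists (T `|` T')%fset => m n.
    rewrite in_fsetU negb_or => /andP[nT nT'].
    by rewrite lact_linearr xT // yT' // scaler0 addr0.
  (* Adding [r] makes the term with [n == r] in the bracket with [Emx r s] vanish. *)
  exists (r |` T)%fset => m n; rewrite in_fset1U negb_or => /andP[nr nT].
  rewrite lact_lieE lact_lie_unit (negbTE nr) scale0r sub0r !wT //.
  by rewrite scaler0 oppr0 add0r (lin0 (lact_linearr _)).
move=> w; rewrite -[w]qreprK; have [] := top_generates FM _ (qrepr w).
  by move=> u; exists S => m n nS; apply: range_top_plus => //; exists u.
move=> T wT; exists T => m n nT; rewrite [LHS]lact_qpi wT //.
exact: qpi0.
Qed.

Hypothesis K0 : char0 K.

Lemma L_irreducible : irreducible U -> irreducible (L_mod S U).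
Proof.
move=> [[u u0] Uirr]; split.
  exists (qpi _ (top u)); apply: contraNneq u0 => /qpi_eq0 /(deg0_free_top K0).
  by move=> /top_eq0 ->.
move=> N' [sN' N'E].
pose N : set M := [set z | N' (qpi (deg0_free (U := U)) z : L_mod S U)].
have sN : submodule N.
  split=> [|x z Nz]; last by rewrite /N /= -[qpi _ _]lact_qpi; exact: N'E.
  split=> [|a x y Nx Ny]; first by rewrite /N /= qpi0; exact: sN'.1.
  by rewrite /N /= qpi_linear; exact: sN'.2.
have [N0|] := pselect (N `&` range (@top K S U) `<=` [set 0]).
  left; apply/seteqP; split=> [x|_ ->]; last exact: sN'.1.
  rewrite -[x]qreprK => Nx; apply/qpi_eq0; apply: subset_span.
  exact: (sub_deg0_free K0 sN N0).
move=> Nn; right; apply/seteqP; split=> // x _; rewrite -[x]qreprK.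
apply: (top_generates sN) => {x} v.
(* The trace of [N] on U is zero or all of U; zero would contradict [Nn]. *)
have sNU : submodule (W := U) [set w | N (top w)].
  split=> [|x w Nw]; last exact: (eq_ind _ N (sN.2 (sublie_val x) _ Nw) _ (lact_glS_top x w)).
  split=> [|a x y Nx Ny]; first exact: (eq_ind_r N sN.1.1 (lin0 (@top_linear K S U))).
  exact: (eq_ind_r N (sN.1.2 a _ _ Nx Ny) (top_linear a x y)).
case: (Uirr _ sNU) => NE; last by move: (NE) => /seteqP[_ /(_ v)]; apply.
exfalso; apply: Nn => z [Nz [w _ wE]]; move: Nz; rewrite -wE => Nw.
have : [set w | N (top w)] w by [].
by rewrite NE => ->; exact: (lin0 (@top_linear K S U)).
Qed.

End SimpleQuotient.

(** * Irreducible modules in the category C *)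

Section SingularVectors.
Context {K : fieldType} (S : {fset int}) (W : lieModType (gl_infty K)).
Local Notation gl := (gl_infty K).

Definition singular : set W :=
  [set w | forall m n : int, n \notin S -> lact (Emx m n : gl) w = 0].

Lemma singular_subspace : subspace singular.
Proof.
split=> [m n _|a x y sx sy m n nS]; first exact: (lin0 (lact_linearr _)).
by rewrite lact_linearr sx // sy // scaler0 addr0.
Qed.

Lemma singular_plus m n v : n \notin S -> singular v -> lact (Emx m n : gl) v = 0.
Proof. by move=> nS; apply. Qed.

Lemma singular_glS m n v : m \in S -> n \in S -> singular v ->
  singular (lact (Emx m n : gl) v).
Proof.
move=> mS nS sv k l lS; rewrite lact_lieE lact_lie_unit (sv m l lS) (sv k l lS).
have -> : l == m = false by apply: contraNF lS => /eqP ->.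
by rewrite scale0r sub0r scaler0 oppr0 add0r (lin0 (lact_linearr _)).
Qed.

Definition sing_pred : {pred W} := fun w => `[< singular w >].

Lemma sing_pred_closed : subsemimod_closed sing_pred.
Proof.
split=> [|a x /asboolP sx]; last by apply/asboolP; exact: (subspaceZ _ singular_subspace).
split=> [|x y /asboolP sx /asboolP sy]; apply/asboolP.
  exact: singular_subspace.1.
exact: (subspaceD singular_subspace).
Qed.

HB.instance Definition _ := GRing.isSubmodClosed.Build K W sing_pred sing_pred_closed.

Record sing_mod : Type := SingMod { sing_val : W; _ : sing_val \in sing_pred }.

HB.instance Definition _ := [isSub for sing_val].
HB.instance Definition _ := [Choice of sing_mod by <:].
HB.instance Definition _ := [SubChoice_isSubLmodule of sing_mod by <:].

Lemma sing_valP (u : sing_mod) : singular (sing_val u).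
Proof. by case: u => u /= /asboolP. Qed.

Lemma sing_mem w : singular w -> w \in sing_pred.
Proof. by move=> sw; apply/asboolP. Qed.

Lemma sing_val_linear : linear sing_val.
Proof. by move=> a x y; exact: (linearP (val : {linear sing_mod -> W})). Qed.

Lemma singular_lact x w : glS K S x -> singular w -> singular (lact x w).
Proof.
move=> sx sw; move: x sx; apply: span_min => [|_ [m [n [mS nS ->]]]]; last first.
  exact: singular_glS.
split=> [|a y z sy sz].
  rewrite /mkset (lin0 (lact_linearl _)); exact: singular_subspace.1.
by rewrite /mkset lact_linearl; exact: singular_subspace.2.
Qed.

Definition sing_lact (x : subLie (glS K S)) (u : sing_mod) : sing_mod :=
  SingMod (sing_mem (singular_lact (sublieP x) (sing_valP u))).

Fact sing_lact_linearl u : linear (sing_lact^~ u).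
Proof.
move=> a x y; apply: val_inj; apply: etrans (esym (sing_val_linear a _ _)).
apply: etrans (congr1 (lact^~ (sing_val u)) (sublie_val_linear a x y)) _.
exact: lact_linearl.
Qed.

Fact sing_lact_linearr x : linear (sing_lact x).
Proof.
move=> a u v; apply: val_inj; apply: etrans (esym (sing_val_linear a _ _)).
apply: etrans (congr1 (lact (sublie_val x)) (sing_val_linear a u v)) _.
exact: lact_linearr.
Qed.

Fact sing_lact_lie x y u :
  sing_lact (lie x y) u = sing_lact x (sing_lact y u) - sing_lact y (sing_lact x u).
Proof.
apply: val_inj; apply: etrans (esym (linB sing_val_linear _ _)).
exact: lact_lie.
Qed.

HB.instance Definition _ := Lmodule_isLieModule.Build K (subLie (glS K S)) sing_mod
  sing_lact_linearl sing_lact_linearr sing_lact_lie.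

Hypothesis K0 : char0 K.
Hypothesis W_irr : irreducible W.

Lemma sing_mod_irreducible w : singular w -> w != 0 -> irreducible sing_mod.
Proof.
move=> sw w0; split.
  exists (SingMod (sing_mem sw)); apply: contraNneq w0 => /(congr1 sing_val) e.
  by apply/eqP; exact: etrans e (lin0 sing_val_linear).
move=> N [sN NE].
have [N0|] := pselect (N `<=` [set 0]).
  by left; apply/seteqP; split=> // _ ->; exact: sN.1.
move=> Nn0; right; apply/seteqP; split=> // u _.
pose P : set W := sing_val @` N.
have Psing : P `<=` singular by move=> _ [v _ <-]; exact: sing_valP.
have Psub : subspace P.
  split; first by exists 0; [exact: sN.1 | exact: (lin0 sing_val_linear)].
  move=> a _ _ [x Nx <-] [y Ny <-]; exists (a *: x + y); first exact: sN.2.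
  exact: sing_val_linear.
have Pplus m n v : n \notin S -> P v -> lact (Emx m n : gl) v = 0.
  by move=> nS /Psing; apply.
have PglS m n v : m \in S -> n \in S -> P v -> P (lact (Emx m n : gl) v).
  move=> mS nS [x Nx <-].
  have Emn : glS K S (Emx m n : gl) by apply: subset_span; exists m, n.
  by exists (lact (SubLie (sublie_mem Emn) : subLie (glS K S)) x) => //; exact: NE.
have [E|E] := W_irr.2 _ (grades_submodule Pplus PglS).
  exfalso; apply: Nn0 => x Nx; apply: val_inj.
  have : span (\bigcup_k grade S P (- k%:Z)) (sing_val x).
    by apply: (P_grades Psub); exists x.
  by rewrite E /= => ->; rewrite [RHS](lin0 sing_val_linear).
have : span (\bigcup_k grade S P (- k%:Z)) (sing_val u) by rewrite E.
case/grades_decomp => n [g [gg uE]].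
(* Uniqueness is applied in the grading built on all singular vectors, where [u] itself has degree
   0; its component [g 0] nevertheless lies in [P]. *)
have gs k : grade S singular (- k%:Z) (g k) by exact: (grade_mono Psing).
have u0 := grade0_component singular_subspace singular_plus K0 (sing_valP u) gs uE.
have : P (g 0%N) by rewrite -(grade0 S Psub); exact: (gg 0%N).
by rewrite -u0 => -[x Nx /val_inj <-].
Qed.

Lemma singular_iso w : singular w -> w != 0 -> lie_isomorphic W (L_mod S sing_mod).
Proof.
move=> sw w0; pose U : lieModType (subLie (glS K S)) := sing_mod.
have j_plus m n (u : U) : n \notin S -> lact (Emx m n : gl) (sing_val u) = 0.
  by move=> nS; exact: sing_valP.
have j_glS m n (u : U) : m \in S -> n \in S ->
    lact (Emx m n : gl) (sing_val u) =
    sing_val (lact (to_glS S (Emx m n : gl)) u).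
  move=> mS nS; rewrite /= truncS_id //.
  by apply: subset_span; exists m, n.
have [f [f_lin f_top f_lact]] : exists f : M_mod S U -> W,
    [/\ linear f, forall u : U, f (top u) = sing_val u &
        forall x z, f (lact x z) = lact x (f z)].
  exists (verma_map sing_val); split.
  - exact: (verma_map_linear sing_val_linear j_plus j_glS).
  - exact: (verma_map_top sing_val_linear j_plus j_glS).
  - exact: (verma_map_lact sing_val_linear j_plus j_glS).
pose J := deg0_free (U := U).
pose N : set (M_mod S U) := [set z | f z = 0].
have sN : submodule N.
  split=> [|x z Nz]; last by rewrite /N /= f_lact Nz (lin0 (lact_linearr _)).
  split=> [|a x y Nx Ny]; first exact: (lin0 f_lin).
  by rewrite /N /= f_lin Nx Ny scaler0 addr0.
(* The map [f] is injective on U, so its kernel meets U trivially. *)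
have NJ : N `<=` J.
  apply: (sub_deg0_free K0 sN) => z [Nz [u _ uE]].
  have u0 : u = 0.
    by apply: val_inj; rewrite -[LHS]f_top uE (Nz : f z = 0) -(lin0 sing_val_linear).
  by rewrite -uE u0; exact: (lin0 (@top_linear _ S U)).
have f_im (Q : set (M_mod S U)) : submodule Q ->
    f @` Q = [set 0] \/ f @` Q = setT.
  move=> [sQ QE]; apply: W_irr.2; split=> [|x _ [z Qz <-]]; last first.
    by exists (lact x z); [exact: QE | exact: f_lact].
  split; first by exists 0; [exact: sQ.1 | exact: (lin0 f_lin)].
  move=> a _ _ [x Qx <-] [y Qy <-]; exists (a *: x + y); [exact: sQ.2|exact: f_lin].
pose u0 : U := SingMod (sing_mem sw).
(* The image of [span J] is 0 or W. If it were W, some z in [span J] would have the image [w] of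
   [top u0], so [top u0] would lie in [span J], contradicting [deg0_free_top]. *)
have JN : span J `<=` N.
  have [JE|JE] := f_im _ (deg0_free_submodule U).
    move=> z Jz; have : (f @` span J) (f z) by exists z.
    by rewrite JE.
  exfalso; have : (f @` span J) w by rewrite JE.
  case=> z Jz zE.
  have /NJ Ju : N (top u0 - z).
    by rewrite /N /= (linB f_lin) f_top zE subrr.
  have : span J (top u0).
    by rewrite -(subrK z (top u0)); apply: spanD Jz; exact: subset_span.
  move/(deg0_free_top K0) => t0; case/eqP: w0.
  by rewrite -[w]/(sing_val u0) -f_top t0 (lin0 f_lin).
have f_surj v : exists z, f z = v.
  have [E|E] := f_im setT (conj (conj I (fun _ _ _ _ _ => I)) (fun _ _ _ => I)).
    case/eqP: w0; rewrite -[w]/(sing_val u0) -f_top.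
    have : (f @` setT) (f (top u0)) by exists (top u0).
    by rewrite E.
  have : (f @` setT) v by rewrite E.
  by case=> z _ zE; exists z.
pose g v := sval (cid (f_surj v)).
have gK v : f (g v) = v by exact: svalP (cid (f_surj v)).
(* Any choice of preimages works: two of them differ by an element of [N], hence of [J]. *)
pose h (v : W) : L_mod S U := qpi J (g v).
have hE v z : f z = v -> h v = qpi J z.
  move=> zE; apply/qpi_eq; apply: subset_span; apply: NJ.
  by rewrite /N /= (linB f_lin) gK zE subrr.
have h_lin : linear h.
  move=> a x y; rewrite (hE _ (a *: g x + g y)); last by rewrite f_lin !gK.
  exact: qpi_linear.
have h_lact x v : h (lact x v) = lact x (h v).
  rewrite (hE _ (lact x (g v))); last by rewrite f_lact gK.
  by rewrite -lact_qpi.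
pose hl : {linear W -> L_mod S U} :=
  HB.pack h (GRing.isLinear.Build K W (L_mod S U) *:%R h h_lin).
exists hl; split=> //.
exists (qlift f) => [v|z].
  rewrite /= /h (qliftE f_lin) ?gK // => x Jx.
  by apply: JN; exact: subset_span.
rewrite -[z]qreprK (qliftE f_lin) => [|x Jx].
  exact: hE.
by apply: JN; exact: subset_span.
Qed.

End SingularVectors.

(* Both directions over the complex numbers [R[i]] *)
Local Close Scope classical_set_scope.
Local Open Scope fset_scope.

Theorem proposition3p4 (R : realType) :
  (forall (S : {fset int}) (U : lieModType (subLie (glS R[i] S))),
     S != fset0 -> irreducible U ->
     irreducible (L_mod S U) /\ in_category_C (L_mod S U))
  /\
  (forall W : lieModType (gl_infty R[i]),
     irreducible W -> in_category_C W ->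
     exists (S : {fset int}) (U : lieModType (subLie (glS R[i] S))),
       [/\ S != fset0, irreducible U & lie_isomorphic W (L_mod S U)]).
Proof.
have K0 : char0 R[i] by move=> n; rewrite pnatr_eq0.
split=> [S U _ Uirr|W Wirr WC].
  by split; [exact: L_irreducible | exact: L_in_category_C].
(* The index 0 is added to make [S] nonempty; enlarging [T] keeps [w] singular. *)
have [[w w0] _] := Wirr; have [T wT] := WC w; pose S : {fset int} := 0 |` T.
have sw : singular S w.
  by move=> m n; rewrite in_fset1U negb_or => /andP[_]; exact: wT.
exists S, (sing_mod S W); split.
- by apply/fset0Pn; exists 0; exact: fset1U1.
- exact: (sing_mod_irreducible K0 Wirr sw w0).
- exact: (singular_iso K0 Wirr sw w0).
Qed.
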